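(* Let $M\geq 2$ be a prime and let $q$ be a prime power with $(M,q)=1$. Let $t$ be the order of $q$ in $(\mathbb Z/M\mathbb Z)^{\times}$. Then, as formal power series in $u$, $$1+\sum_{n=1}^{\infty}c(n,q,M)_{\mathrm{ss}}\,u^n=c(q,u)\,c(q^t,u^t)^{\frac{1-M}{Mt}}\prod_{k=1}^{\infty}c(q^t,u^{M^kt})^{\frac{(1-M)^2}{M^{k+1}t}}.$$
   Context: $c(q,u)=\dfrac{1-u}{1-qu}$, viewed as a formal power series in $u$ with constant term $1$; $c(q^t,u^{m})$ is obtained by substituting $q^t$ for $q$ and $u^m$ for $u$. Rational powers of a power series with constant term $1$ are taken by the binomial series (so they again have constant term $1$). $\mathrm{GL}(n,q)$ is the group of invertible $n\times n$ matrices over the field $\mathbb F_q$ with $q$ elements. A conjugacy class is semisimple if for its elements $\alpha$ the $\mathbb F_q[x]$-module $\mathbb F_q^n$ defined by $\alpha$ is a direct sum of modules $\mathbb F_q[x]/(f)$ with $f$ monic irreducible, $f\neq x$. $c(n,q,M)_{\mathrm{ss}}$ is the number of semisimple conjugacy classes of $\mathrm{GL}(n,q)$ contained in the image of the power map $x\mapsto x^M$ on $\mathrm{GL}(n,q)$. *)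

(* Defs.v *)
(* boolp serves only to count classes by a Prop predicate. *)
From mathcomp Require Export all_boot all_order all_algebra all_fingroup boolp.
Set Implicit Arguments.
Unset Strict Implicit.
Unset Printing Implicit Defensive.
Import GRing.Theory.
Local Open Scope ring_scope.

(* A formal power series over rat, as its coefficient sequence. *)
Definition fps := nat -> rat.

Definition fps_of_poly (p : {poly rat}) : fps := fun n => p`_n.

Definition fps_one : fps := fun n => (n == 0%N)%:R.

Definition fps_mul (f g : fps) : fps :=
  fun n => \sum_(i < n.+1) f i * g (n - i)%N.

Definition fps_exp (f : fps) (k : nat) : fps := iter k (fps_mul f) fps_one.

(* f(u^m); meant for m > 0. *)
Definition fps_comp_Xn (m : nat) (f : fps) : fps :=
  fun n => if (m %| n)%N then f (n %/ m)%N else 0.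

Definition gbinom (a : rat) (k : nat) : rat :=
  (\prod_(i < k) (a - i%:R)) / (k`!)%:R.

(* The binomial series \sum_k gbinom a k * (f - 1)^k, for f with constant
   term 1.  Since u^k divides (f - 1)^k, only the terms with k <= n
   contribute to the coefficient of u^n. *)
Definition fps_pow (f : fps) (a : rat) : fps := fun n =>
  \sum_(k < n.+1) gbinom a k * fps_exp (fun m => f m - fps_one m) k n.

(* P is the limit of the partial products F 1 * ... * F N in the u-adic
   topology: each coefficient is eventually constant. *)
Definition fps_infprod (F : nat -> fps) (P : fps) : Prop :=
  forall n, exists N0, forall N, (N0 <= N)%N ->
    (\big[fps_mul/fps_one]_(1 <= k < N.+1) F k) n = P n.

Definition fps_geom (Q : rat) : fps := fun n => Q ^+ n.

Lemma fps_geomE (Q : rat) :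
  fps_mul (fps_of_poly (1 - Q *: 'X)) (fps_geom Q) =1 fps_one.
Proof.
case=> [|n]; rewrite /fps_mul /fps_of_poly /fps_geom /fps_one.
  by rewrite big_ord_recl big_ord0 !coefE /= mulr0 subr0 mulr1 addr0.
rewrite !big_ord_recl big1 => [|i _].
  rewrite !coefE /= mulr0 mulr1 subr0 sub0r addr0 mul1r /bump /= subn0 subn1.
  by rewrite exprS mulNr subrr.
by rewrite !coefE /= mulr0 subr0 mul0r.
Qed.

(* c(Q, u) = (1 - u) / (1 - Q u) *)
Definition cser (Q : rat) : fps :=
  fps_mul (fps_of_poly (1 - 'X)) (fps_geom Q).

(* The F[x]-module structure on F^n.+1 defined by A lets p act as p(A).  An
   isomorphism from it to the direct sum of the F[x]/(f i) is a bijection that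
   is additive and commutes with the action of every polynomial. *)
Definition semisimple_mx (F : finFieldType) (n : nat) (A : 'M[F]_n.+1) : Prop :=
  exists (k : nat) (f : 'I_k -> {poly F})
    (phi : 'cV[F]_n.+1 -> {dffun forall i : 'I_k, {poly %/ f i}}),
  [/\ forall i, [/\ f i \is monic, irreducible_poly (f i) & f i != 'X],
      bijective phi,
      forall u v i, phi (u + v) i = phi u i + phi v i
    & forall p v i, phi (horner_mx A p *m v) i = in_qpoly (f i) p * phi v i].

Definition semisimple_class (F : finFieldType) (n : nat)
    (C : {set {'GL_n[F]}}) : Prop :=
  forall a, a \in C -> semisimple_mx (GLval a).

(* {'GL_n[F]} is the group of invertible n x n matrices for n > 0 only. *)
Definition c_ss (F : finFieldType) (n M : nat) : nat :=
  #|[set C in classes [set: {'GL_n[F]}] |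
      `[< semisimple_class C >]
      && (C \subset [set (x ^+ M)%g | x : {'GL_n[F]}])]|.

Definition ss_series (F : finFieldType) (M : nat) : fps :=
  fun n => if n == 0%N then 1 else (c_ss F n M)%:R.

(* Main.v *)
From HB Require Import structures.
Require Import Defs.
From mathcomp Require Import all_solvable all_field zify ring.
Set Implicit Arguments.
Unset Strict Implicit.
Unset Printing Implicit Defensive.
Import GRing.Theory Num.Theory.
Local Open Scope ring_scope.

(** Write q for the number of elements of F.  A semisimple class of GL(n, q) is
    a multiset of monic irreducible polynomials f <> X of total degree n: the
    multiplicity of f can be read off the number of vectors killed by f(A)
    [card_ker], and equal multiplicities give isomorphic modules
    [decomposes_conj].

    Such a class consists of M-th powers exactly when every f whose root x is
    not an M-th power in the residue field E = F[X]/(f) has multiplicity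
    divisible by M.  Necessity is a determinant argument: if A = Y^M, then Y
    acts E-linearly on the kernel E^r of f(A), its M-th power there is the
    scalar x, hence det(Y)^M = x^r, and r prime to M would make x an M-th power
    [nonpower_multiplicity].  Conversely x is the M-th power of a weighted
    cyclic shift on E^M, and the M-th power of a scalar if x has a root in E
    [model_root].  So the classes to count are free multisets of blocks, a
    block of f having size w(f) = deg f or M * deg f [c_ssE], and their
    generating series is the product over f of 1 / (1 - u^w(f)) [geomD_prod].

    Series with constant term 1 over the rationals are compared through their
    logarithmic derivatives u f'/f [logder_uniq]; these turn products into sums,
    rational powers into multiples [logder_pow], and make c(Q, u) into the
    series with coefficients Q^m - 1 [logder_cser].  For the counting series
    the coefficient of u^m is the sum of w(f) over the f with w(f) | m, which
    is (q^m - 1) - S(m) + M S(m / M) where S(m) is the sum of deg f over the f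
    with deg f | m whose root is not an M-th power, and S is 0 outside the
    integers [wdeg_sum].  Such a root stays outside the M-th powers of the
    field with q^m elements unless M divides m / deg f [nonpower_extension],
    and that field has T(m) = (q^m - 1)(M - 1)/M nonzero elements that are not
    M-th powers if t | m, and none otherwise.  Thus S(m) = T(m) + S(m / M)
    [nonpower_degs_rec], and the coefficient of u^m becomes (q^m - 1) - T(m)
    plus (M - 1) times the sum of the T(m / M^k) for k >= 1: these are the
    contributions of c(q, u), of the power of c(q^t, u^t) and of the factors of
    the infinite product [ss_coef]. *)

(** * Formal power series and logarithmic derivatives *)

HB.instance Definition _ := Choice.copy fps (nat -> rat).

Definition fps_zero : fps := fun=> 0.
Definition fps_add (f g : fps) : fps := fun n => f n + g n.
Definition fps_opp (f : fps) : fps := fun n => - f n.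

Fact fps_addA : associative fps_add.
Proof. by move=> f g h; apply/funext => n; rewrite /fps_add addrA. Qed.
Fact fps_addC : commutative fps_add.
Proof. by move=> f g; apply/funext => n; rewrite /fps_add addrC. Qed.
Fact fps_add0 : left_id fps_zero fps_add.
Proof. by move=> f; apply/funext => n; rewrite /fps_add add0r. Qed.
Fact fps_addN : left_inverse fps_zero fps_opp fps_add.
Proof. by move=> f; apply/funext => n; rewrite /fps_add addNr. Qed.

HB.instance Definition _ :=
  GRing.isZmodule.Build fps fps_addA fps_addC fps_add0 fps_addN.

(** A coefficient of a product only involves finitely many coefficients of the
    factors, so the ring laws of series are those of their truncations. *)
Definition fps_trunc (N : nat) (f : fps) : {poly rat} := \poly_(i < N) f i.

Lemma coef_trunc N f n : (n < N)%N -> (fps_trunc N f)`_n = f n.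
Proof. by move=> nN; rewrite coef_poly nN. Qed.

Lemma coef_trunc_mul N f g n :
  (n < N)%N -> (fps_trunc N f * fps_trunc N g)`_n = fps_mul f g n.
Proof.
move=> nN; rewrite coefM; apply: eq_bigr => -[i /= lt_in] _.
by rewrite !coef_trunc ?(leq_ltn_trans (leq_subr _ _)) // (leq_ltn_trans _ nN).
Qed.

Fact fps_mulC : commutative fps_mul.
Proof. by move=> f g; apply/funext => n; rewrite -!(@coef_trunc_mul n.+1) // mulrC. Qed.

Fact fps_mulA : associative fps_mul.
Proof.
move=> f g h; apply/funext => n.
transitivity ((fps_trunc n.+1 f * (fps_trunc n.+1 g * fps_trunc n.+1 h))`_n).
  rewrite coefM; apply: eq_bigr => i _.
  by rewrite coef_trunc // coef_trunc_mul // ltnS leq_subr.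
rewrite mulrA coefM; apply: eq_bigr => i _.
by rewrite coef_trunc_mul // coef_trunc // ltnS leq_subr.
Qed.

Fact fps_mul1 : left_id fps_one fps_mul.
Proof.
move=> f; apply/funext => n; rewrite /fps_mul big_ord_recl subn0 mul1r.
by rewrite big1 ?addr0 // => i _; rewrite /fps_one /= mul0r.
Qed.

Fact fps_mulDl : left_distributive fps_mul fps_add.
Proof.
move=> f g h; apply/funext => n; rewrite /fps_add /fps_mul -big_split /=.
by apply: eq_bigr => i _; rewrite mulrDl.
Qed.

Fact fps_one_neq0 : fps_one != fps_zero.
Proof. by apply/eqP => /(congr1 (fun f : fps => f 0%N))/eqP; rewrite oner_eq0. Qed.

HB.instance Definition _ := GRing.Zmodule_isComNzRing.Build fps
  fps_mulA fps_mulC fps_mul1 fps_mulDl fps_one_neq0.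

Section PowerSeries.
Implicit Types (f g L : fps).

Lemma fpsM f g n : (f * g) n = \sum_(i < n.+1) f i * g (n - i)%N.
Proof. by []. Qed.
Lemma fpsD f g n : (f + g) n = f n + g n. Proof. by []. Qed.
Lemma fpsB f g n : (f - g) n = f n - g n. Proof. by []. Qed.
Lemma fps1E n : (1 : fps) n = (n == 0%N)%:R. Proof. by []. Qed.

Lemma fps_sumE (I : Type) (r : seq I) (P : pred I) (G : I -> fps) n :
  (\sum_(i <- r | P i) G i) n = \sum_(i <- r | P i) G i n.
Proof. by apply: (big_morph (fun f : fps => f n)). Qed.

Lemma fps_expE f k : fps_exp f k = f ^+ k.
Proof. by elim: k => //= k IHk; rewrite exprS -IHk. Qed.

Lemma fpsM0 f g : (f * g) 0%N = f 0%N * g 0%N.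
Proof. by rewrite fpsM big_ord1. Qed.

(** Scalars embedded as constant series, so that ring identities apply. *)
Definition fpsC (c : rat) : fps := fun n => if n == 0%N then c else 0.

Lemma fpsC_mul c f n : (fpsC c * f) n = c * f n.
Proof.
rewrite fpsM big_ord_recl subn0 big1 ?addr0 // => i _.
by rewrite /fpsC /= mul0r.
Qed.

Lemma fpsCD c d : fpsC (c + d) = fpsC c + fpsC d.
Proof. by apply/funext => -[|n]; rewrite fpsD /fpsC /= ?addr0. Qed.

Lemma fpsCM c d : fpsC (c * d) = fpsC c * fpsC d.
Proof. by apply/funext => -[|n]; rewrite fpsC_mul /fpsC /= ?mulr0. Qed.

(** The derivation u d/du, which unlike d/du does not shift indices. *)
Definition euler f : fps := fun n => n%:R * f n.

Lemma eulerE f n : euler f n = n%:R * f n. Proof. by []. Qed.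

Lemma eulerM f g : euler (f * g) = euler f * g + f * euler g.
Proof.
apply/funext => n; rewrite fpsD !fpsM /euler -big_split /= fpsM mulr_sumr.
apply: eq_bigr => i _; rewrite -{1}(subnKC (leq_ord i)) natrD; ring.
Qed.

Lemma eulerD f g : euler (f + g) = euler f + euler g.
Proof. by apply/funext => n; rewrite fpsD /euler fpsD mulrDr. Qed.

Lemma eulerC c : euler (fpsC c) = 0.
Proof. by apply/funext => -[|n]; rewrite /euler /fpsC /= ?mul0r ?mulr0. Qed.

Lemma euler1 : euler 1 = 0.
Proof. by apply/funext => -[|n]; rewrite /euler /= ?mul0r ?mulr0. Qed.

Lemma euler_sum (I : Type) (r : seq I) (P : pred I) (G : I -> fps) :
  euler (\sum_(i <- r | P i) G i) = \sum_(i <- r | P i) euler (G i).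
Proof.
apply: (big_morph euler eulerD).
by apply/funext => n; rewrite /euler mulr0.
Qed.

Lemma eulerX f k : euler (f ^+ k.+1) = k.+1%:R * f ^+ k * euler f.
Proof.
elim: k => [|k IHk]; first by rewrite !expr1 mul1r mul1r.
by rewrite exprS eulerM IHk -[k.+2%:R]natr1 exprS; ring.
Qed.

(** The relation L = u f'/f, without division of series. *)
Definition logder f L := euler f = f * L.

Lemma logder0 f L : f 0%N = 1 -> logder f L -> L 0%N = 0.
Proof.
move=> f0 /(congr1 (fun g : fps => g 0%N)).
by rewrite /euler fpsM0 f0 mul0r mul1r.
Qed.

(** Comparing coefficients of u^n in u f' = f L expresses n * f_n through the
    f_i with i < n, because L has no constant term; n is invertible. *)
Lemma logder_uniq N f g L L' :
    f 0%N = 1 -> g 0%N = 1 -> (forall i, (i <= N)%N -> L i = L' i) ->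
    logder f L -> logder g L' ->
  forall n, (n <= N)%N -> f n = g n.
Proof.
move=> f0 g0 LL' fL gL'.
have L0 := logder0 f0 fL; have L'0 := logder0 g0 gL'.
elim/ltn_ind => -[_ _|n IHn nN]; first by rewrite f0 g0.
have nz : n.+1%:R != 0 :> rat by rewrite pnatr_eq0.
apply: (mulfI nz).
have := congr1 (fun h : fps => h n.+1) fL.
have := congr1 (fun h : fps => h n.+1) gL'.
rewrite /euler => -> ->; rewrite !fpsM [LHS]big_ord_recr [RHS]big_ord_recr /=.
rewrite subnn L0 L'0 !mulr0.
congr (_ + 0); apply: eq_bigr => i _; rewrite IHn //; last first.
  by rewrite ltnW // (leq_trans _ nN) // ltn_ord.
by rewrite LL' // (leq_trans _ nN) // leq_subr.
Qed.

Lemma logder1 : logder 1 0.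
Proof. by rewrite /logder euler1 mulr0. Qed.

Lemma logderM f g L L' : logder f L -> logder g L' -> logder (f * g) (L + L').
Proof. by move=> fL gL'; rewrite /logder eulerM fL gL'; ring. Qed.

Lemma logder_prod (I : Type) (r : seq I) (P : pred I) (G L : I -> fps) :
  (forall i, P i -> logder (G i) (L i)) ->
  logder (\prod_(i <- r | P i) G i) (\sum_(i <- r | P i) L i).
Proof.
move=> GL; elim/big_rec2: _ => [|i f g Pi fg]; first exact: logder1.
by apply: logderM => //; apply: GL.
Qed.

Lemma fps_prod0 (I : Type) (r : seq I) (P : pred I) (G : I -> fps) :
  (forall i, P i -> G i 0%N = 1) -> (\prod_(i <- r | P i) G i) 0%N = 1.
Proof.
by move=> G0; elim/big_rec: _ => // i f Pi f0; rewrite fpsM0 f0 G0 ?mulr1.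
Qed.

Lemma fps_mul_low f g m n :
  (forall i, (i < m)%N -> f i = 0) -> (n < m)%N -> (f * g) n = 0.
Proof.
move=> f0 nm; rewrite fpsM big1 // => i _.
by rewrite f0 ?mul0r // (leq_ltn_trans (leq_ord i)).
Qed.

Lemma fps_exp_low f k n : f 0%N = 0 -> (n < k)%N -> (f ^+ k) n = 0.
Proof.
move=> f0; elim: k n => // k IHk n; rewrite ltnS => nk.
rewrite exprSr fpsM big_ord_recr /= subnn f0 mulr0 addr0 big1 // => i _.
by rewrite IHk ?mul0r // (leq_trans (ltn_ord i)).
Qed.

Lemma fps_mul_eq m f f' g g' :
  (forall i, (i <= m)%N -> f i = f' i) -> (forall i, (i <= m)%N -> g i = g' i) ->
  forall i, (i <= m)%N -> (f * g) i = (f' * g') i.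
Proof.
move=> ff gg n nm; rewrite !fpsM; apply: eq_bigr => i _.
rewrite ff ?gg // ?(leq_trans (leq_subr _ _)) //.
by rewrite (leq_trans (leq_ord i)).
Qed.

(** The coefficients of the differential equation (1 + g) B'(g) = a B(g) of the
    binomial series B. *)
Lemma gbinomS a k : k.+1%:R * gbinom a k.+1 + k%:R * gbinom a k = a * gbinom a k.
Proof.
rewrite /gbinom big_ord_recr /= factS natrM.
set p := \prod_(i < k) _; have nz : k.+1%:R != 0 :> rat by rewrite pnatr_eq0.
have nz' : (k`!)%:R != 0 :> rat by rewrite pnatr_eq0 -lt0n fact_gt0.
by field; rewrite nz' addrC natr1 nz.
Qed.

Lemma fps_pow0 f a : f 0%N = 1 -> fps_pow f a 0%N = 1.
Proof.
move=> f0; rewrite /fps_pow big_ord1 fps_expE expr0 fps1E mulr1.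
by rewrite /gbinom big_ord0 divr1.
Qed.

(** A finite sum that agrees with the binomial series below degree K, to which
    the ring operations and [euler] can be applied. *)
Definition fps_pow_part f a K : fps := \sum_(k < K) fpsC (gbinom a k) * (f - 1) ^+ k.

Lemma fps_pow_partE f a K n :
  f 0%N = 1 -> (n < K)%N -> fps_pow f a n = fps_pow_part f a K n.
Proof.
move=> f0 nK; rewrite /fps_pow /fps_pow_part fps_sumE.
rewrite (big_ord_widen K (fun k => gbinom a k * fps_exp (f - 1) k n) nK).
rewrite big_mkcond; apply: eq_bigr => k _; rewrite fpsC_mul fps_expE.
case: ltnP => // nk; rewrite fps_exp_low ?mulr0 //.
by rewrite fpsB f0 subrr.
Qed.

(** The binomial series satisfies (1 + g) B'(g) = a B(g); with g = f - 1 and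
    u g' = f L = (1 + g) L this gives u B(g)' = a B(g) L.  It is checked one
    coefficient at a time, on partial sums. *)
Lemma logder_pow f L a :
  f 0%N = 1 -> logder f L -> logder (fps_pow f a) (fpsC a * L).
Proof.
move=> f0 fL; apply/funext => n; set g := f - 1.
have g0 : g 0%N = 0 by rewrite /g fpsB f0 subrr.
have eg : euler g = (1 + g) * L.
  rewrite [1 + g]addrC subrK -fL.
  by apply/funext => -[|m]; rewrite !eulerE ?mul0r // /g fpsB subr0.
rewrite {1}/euler (@fps_pow_partE f a n.+2) // -/(euler _ n).
rewrite (@fps_mul_eq n _ (fps_pow_part f a n.+1) _ (fpsC a * L)) //; last first.
  by move=> i iN; apply: fps_pow_partE.
(* The second summand is the truncation error, of order at least n + 1. *)
have -> : euler (fps_pow_part f a n.+2) =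
    fps_pow_part f a n.+1 * (fpsC a * L)
    + g ^+ n.+1 * (fpsC (n.+1%:R * gbinom a n.+1) * L).
  rewrite euler_sum big_ord_recl mulr1 eulerC add0r.
  under eq_bigr => k _ do rewrite eulerM eulerC mul0r add0r eulerX eg.
  rewrite /fps_pow_part -/g.
  elim: n.+1 => [|K IHK].
    by rewrite !big_ord0 !expr0 /= mul0r mul1r; apply/funext=> m;
      rewrite fpsD fpsC_mul !mul0r.
  rewrite !big_ord_recr /= IHK /bump /= add1n.
  have E : fpsC (K.+1%:R) * fpsC (gbinom a K.+1) + fpsC (K%:R) * fpsC (gbinom a K)
     = fpsC a * fpsC (gbinom a K).
    by rewrite -!fpsCM -fpsCD gbinomS.
  have N m : (m%:R : fps) = fpsC m%:R.
    elim: m => [|m IHm]; first by apply/funext => -[].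
    by rewrite -[in LHS]natr1 IHm -natr1 fpsCD; congr (_ + _); apply/funext => -[].
  rewrite N (fpsCM K%:R) (fpsCM K.+1%:R).
  transitivity ((\sum_(i < K) fpsC (gbinom a i) * g ^+ i) * (fpsC a * L) +
    g ^+ K * L * (fpsC K%:R * fpsC (gbinom a K)
      + fpsC K.+1%:R * fpsC (gbinom a K.+1))
    + g ^+ K.+1 * L * (fpsC K.+1%:R * fpsC (gbinom a K.+1))).
    by rewrite exprS; ring.
  by rewrite [fpsC K%:R * _ + _]addrC E; ring.
rewrite fpsD [X in _ + X](@fps_mul_low _ _ n.+1) ?addr0 // => i iN.
exact: fps_exp_low.
Qed.

Lemma comp_XnE m f n :
  fps_comp_Xn m f n = if (m %| n)%N then f (n %/ m)%N else 0.
Proof. by []. Qed.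

Lemma comp_Xn0 m f : (0 < m)%N -> fps_comp_Xn m f 0%N = f 0%N.
Proof. by move=> m0; rewrite /fps_comp_Xn dvdn0 div0n. Qed.

Lemma comp_XnM m f g : (0 < m)%N ->
  fps_comp_Xn m (f * g) = fps_comp_Xn m f * fps_comp_Xn m g.
Proof.
move=> m0; apply/funext => n; rewrite comp_XnE [RHS]fpsM.
have [mn|mn] := boolP (m %| n)%N; last first.
  rewrite big1 // => i _; rewrite !comp_XnE.
  have [mi|] := boolP (m %| i)%N; last by rewrite mul0r.
  by rewrite dvdn_subl ?leq_ord // (negPf mn) mulr0.
have -> : \sum_(i < n.+1) fps_comp_Xn m f i * fps_comp_Xn m g (n - i)%N
   = \sum_(i < n.+1 | (m %| i)%N) f (i %/ m)%N * g ((n - i) %/ m)%N.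
  rewrite [RHS]big_mkcond; apply: eq_bigr => i _; rewrite !comp_XnE.
  case: ifP => [mi|_]; last by rewrite mul0r.
  by rewrite dvdn_subr ?leq_ord // mi.
rewrite fpsM (reindex_onto (fun j : 'I_(n %/ m).+1 => inord (j * m) : 'I_n.+1)
   (fun i : 'I_n.+1 => inord (i %/ m))) /=.
  have E (j : 'I_(n %/ m).+1) : (inord (j * m) : 'I_n.+1) = (j * m)%N :> nat.
    by rewrite inordK // ltnS -leq_divRL // leq_ord.
  apply: eq_big => [j|j _].
    by rewrite E dvdn_mull // mulnK // inord_val eqxx.
  rewrite E mulnK //; congr (_ * g _).
  by rewrite [X in (X - _ * _)%N](divn_eq n m) (eqP mn) addn0 -mulnBl mulnK.
move=> i mi; apply/val_inj.
by rewrite /= !inordK ?divnK // ?ltnS ?leq_div2r // ?leq_ord.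
Qed.

Lemma logder_comp_Xn m f L : (0 < m)%N -> logder f L ->
  logder (fps_comp_Xn m f) (fpsC m%:R * fps_comp_Xn m L).
Proof.
move=> m0 fL; rewrite /logder mulrCA -comp_XnM // -fL.
apply/funext => n; rewrite fpsC_mul !comp_XnE /euler comp_XnE.
case: ifP => [mn|_]; last by rewrite !mulr0.
by rewrite mulrA -natrM mulnC divnK.
Qed.

(** The logarithmic derivative of 1 / (1 - Q u). *)
Definition fps_powers Q : fps := fun n => if n == 0%N then 0 else Q ^+ n.

Lemma geomV Q : fps_of_poly (1 - Q *: 'X) * fps_geom Q = 1.
Proof. by apply/funext; apply: fps_geomE. Qed.

Lemma logder_geom Q : logder (fps_geom Q) (fps_powers Q).
Proof.
have E : fps_geom Q = 1 + fps_powers Q.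
  by apply/funext => -[|n]; rewrite fpsD /= ?addr0 ?add0r ?expr0.
have H : euler (fps_of_poly (1 - Q *: 'X))
  = - (fps_of_poly (1 - Q *: 'X) * fps_powers Q).
  apply/eqP; rewrite -addr_eq0; apply/eqP.
  have /eqP := geomV Q; rewrite {1}E mulrDr mulr1 eq_sym addrC -subr_eq => /eqP <-.
  apply/funext => n; rewrite fpsD fpsB /euler /fps_of_poly fps1E !coefE.
  case: n => [|[|n]] /=; rewrite ?mulr0 ?mulr1 ?mul0r ?subr0 ?sub0r ?add0r ?addr0
    ?opprK ?subrr ?oppr0 //.
  by rewrite mul1r addNr.
have U := geomV Q.
have := congr1 euler U; rewrite eulerM H euler1 => /(congr1 (fun h => fps_geom Q * h)).
rewrite mulr0 => H2.
have H3 : fps_of_poly (1 - Q *: 'X) * fps_geom Q *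
    (euler (fps_geom Q) - fps_geom Q * fps_powers Q) = 0.
  by rewrite -[RHS]H2; ring.
by move/eqP: H3; rewrite U mul1r subr_eq0 => /eqP.
Qed.

Lemma cser0 Q : cser Q 0%N = 1.
Proof.
rewrite -[cser Q]/(fps_of_poly (1 - 'X) * fps_geom Q) fpsM0.
by rewrite /fps_of_poly /fps_geom !coefE subr0 mulr1.
Qed.

(** The logarithmic derivative of (1 - u) / (1 - Q u). *)
Definition cser_log Q : fps := fps_powers Q - fps_powers 1.

Lemma logder_cser Q : logder (cser Q) (cser_log Q).
Proof.
rewrite /cser_log addrC; apply: logderM (logder_geom Q).
have H := logder_geom 1; have U := geomV 1; rewrite scale1r in U.
have := congr1 euler U; rewrite eulerM euler1 H.
move=> /(congr1 (fun h => fps_of_poly (1 - 'X) * h)).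
rewrite mulr0 => H2; rewrite /logder; apply/eqP; rewrite -subr_eq0; apply/eqP.
rewrite -[RHS]H2 mulrN opprK mulrDr mulrCA [_ * fps_geom 1]mulrC.
transitivity ((fps_of_poly (1 - 'X) * fps_geom 1) * (euler (fps_of_poly (1 - 'X))
  + fps_of_poly (1 - 'X) * fps_powers 1)); last by ring.
by rewrite U mul1r.
Qed.

Lemma cser_logE Q n : cser_log Q n = if n == 0%N then 0 else Q ^+ n - 1.
Proof. by rewrite /cser_log fpsB /fps_powers; case: n => [|n] /=;
  rewrite ?subrr ?expr1n. Qed.
End PowerSeries.

(** * Irreducible polynomials over a finite field and power residues *)

(** The polynomials that index simple modules on which X acts invertibly.
    Locked, because the decision is classical and must not be unfolded when
    boolean conjunctions are rearranged. *)
HB.lock Definition irr_notX (F : fieldType) (f : {poly F}) : bool :=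
  `[< [/\ f \is monic, irreducible_poly f & f != 'X] >].

Lemma irr_notXP (F : fieldType) (f : {poly F}) :
  reflect [/\ f \is monic, irreducible_poly f & f != 'X] (irr_notX f).
Proof. by rewrite irr_notX.unlock; apply: asboolP. Qed.

Section FactorDegrees.
Variable F : fieldType.
Implicit Types (f g p : {poly F}).

Lemma irr_eqp f g : f \is monic -> irreducible_poly f -> g \is monic ->
  irreducible_poly g -> (f %| g) = (f == g).
Proof.
move=> fm fi gm [gs gi]; apply/idP/eqP => [fg|->//].
apply/eqP; rewrite -eqp_monic //; apply: gi => //.
by case: fi => fs _; rewrite neq_ltn fs orbT.
Qed.

Lemma irr_dvd_mul f g p : irreducible_poly f -> (f %| g * p) = (f %| g) || (f %| p).
Proof.
move=> fi; have [fg|nfg] := boolP (f %| g); first by rewrite dvdp_mulr.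
by rewrite Gauss_dvdpr // irreducible_poly_coprime.
Qed.

Lemma exists_irr_factor p : (1 < size p)%N ->
  exists g, [/\ g \is monic, irreducible_poly g & g %| p].
Proof.
move: {2}(size p) (leqnn (size p)) => n; elim: n p => [|n IHn] p pn p1.
  by move: pn; rewrite leqn0 => /eqP E; rewrite E in p1.
have p0 : p != 0 by rewrite -size_poly_gt0 ltnW.
have [H|H] := pselect (irreducible_poly p).
  have lc : (lead_coef p)^-1 != 0 by rewrite invr_eq0 lead_coef_eq0.
  exists ((lead_coef p)^-1 *: p); split; last by rewrite dvdpZl.
    by rewrite monicE lead_coefZ mulVf // lead_coef_eq0.
  split; first by rewrite size_scale.
  by move=> d d1; rewrite dvdpZr // => dp;
    rewrite (eqp_trans (H.2 d d1 dp)) // eqp_sym eqp_scale.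
have [d [d1 dp dnp]] : exists d : {poly F}, [/\ size d != 1%N, d %| p & ~~ (d %= p)].
  apply: contrapT => N; apply: H; split=> // d d1 dp; apply/negPn/negP => dnp.
  by apply: N; exists d.
have sd : (size d < size p)%N by rewrite ltn_neqAle dvdp_leq // andbT dvdp_size_eqp.
have [||g [gm gi gd]] := IHn d; first by rewrite -ltnS (leq_trans sd).
  by rewrite ltn_neqAle eq_sym d1 size_poly_gt0; apply: contraTneq dp => ->;
    rewrite dvd0p.
by exists g; split=> //; apply: dvdp_trans dp.
Qed.
End FactorDegrees.

Section FiniteField.
Variable F : finFieldType.
Implicit Types (f g p : {poly F}).
Notation q := #|F|.

(** A monic separable polynomial is the product of its distinct monic
    irreducible divisors.  By induction, splitting off one divisor g: it does
    not divide the cofactor, which is coprime to it. *)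
Lemma sum_deg_factors N p : separable_poly p -> p \is monic -> (size p <= N)%N ->
  (\sum_(f : {poly_N F} | `[< (f : {poly F}) \is monic /\ irreducible_poly f >]
    && ((f : {poly F}) %| p)%R)
     (size f).-1 = (size p).-1)%N.
Proof.
elim: {p}(size p).+1 {-2}p (ltnSn (size p)) => // n IHn p pn ps pm pN.
have [p1|] := leqP (size p) 1.
  have : p == 1 by rewrite -eqp_monic ?monic1 // -size_poly_eq1 eqn_leq p1
    size_poly_gt0 monic_neq0.
  move=> /eqP E; rewrite E size_poly1 big1 // => f /andP[/asboolP[fm [f1 _]]].
  by rewrite dvdp1 => /eqP E2; rewrite E2 in f1.
move=> /exists_irr_factor [g [gm gi gp]].
have [p' E] : exists p', p = p' * g by exists (p %/ g); rewrite divpK.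
have p'm : p' \is monic by rewrite E monicMr in pm.
have sg : (1 < size g)%N by case: gi.
have sE : size p = (size p' + size g).-1 by rewrite E size_monicM // monic_neq0.
have p'0 : (0 < size p')%N by rewrite size_poly_gt0 monic_neq0.
have gN : (size g <= N)%N by apply: leq_trans pN; rewrite dvdp_leq // monic_neq0.
move: ps; rewrite {1}E separable_mul => /and3P[p's gs co].
have K : npolyp N g = g :> {poly F} by rewrite npolypK.
rewrite (bigD1 (npolyp N g)) /=; last first.
  by rewrite K gp andbT; apply/asboolP.
transitivity ((size g).-1 + (size p').-1)%N; last by rewrite sE; lia.
rewrite K; congr (_ + _)%N.
rewrite -(IHn p') //; [|by lia|by lia].
apply: eq_bigl => f; rewrite -andbA; apply: andb_id2l => /asboolP[fm fi].
have -> : (f != npolyp N g) = (f != g :> {poly F}) by rewrite -val_eqE /= K.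
rewrite E irr_dvd_mul // (irr_eqp fm fi gm gi).
have [fg|_] := eqVneq (f : {poly F}) g; last by rewrite andbT orbF.
rewrite andbF fg; apply/esym/negP => gp'.
move: co; rewrite coprimep_sym irreducible_poly_coprime //.
by rewrite gp'.
Qed.

Lemma pchar_nat_card : [pchar F].-nat q.
Proof.
have [p p_pr pF] := finPcharP F.
have := abelem_pgroup (fin_ring_pchar_abelem pF); rewrite /pgroup cardsT.
by apply: sub_in_pnat => r _ /eqP ->.
Qed.

Lemma card_natr0 : q%:R = 0 :> F.
Proof.
have [p p_pr pF] := finPcharP F.
have /p_natP[e qe] : p.-nat q.
  by have := abelem_pgroup (fin_ring_pchar_abelem pF); rewrite /pgroup cardsT.
have := finNzRing_gt1 F; rewrite qe; case: e {qe} => // e _.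
by rewrite natrX exprS (pcharf0 pF) mul0r.
Qed.

Section OneFactor.
Variable f : {poly F}.
Hypothesis fi : irr_notX f.
Let d := (size f).-1.

Lemma irr_notX_mi : monic_irreducible_poly f.
Proof. by case/irr_notXP: fi. Qed.

Local Notation E := {poly %/ f with irr_notX_mi}.
Definition qx : E := in_qpoly f 'X.

Lemma deg_gt0 : (0 < d)%N.
Proof. by have [[f1 _] _] := irr_notX_mi; rewrite /d; case: (size f) f1 => [|[]]. Qed.

Lemma in_qpoly_eq0 p : (in_qpoly f p == 0) = (f %| p).
Proof.
have hM : f \is monic := irr_notX_mi.2.
apply/eqP/idP => [/val_eqP /= | hDp].
  by rewrite -Pdiv.IdomainMonic.modpE mk_monicE //; exact: irr_notX_mi.
by apply/val_eqP; rewrite /= -Pdiv.IdomainMonic.modpE mk_monicE //; exact: irr_notX_mi.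
Qed.

Lemma qx_neq0 : qx != 0.
Proof.
rewrite [qx == 0]in_qpoly_eq0; have [fm fir fX] := irr_notXP _ fi.
apply: contra fX => fX.
have [_ iX] := irredp_XsubC (0 : F); rewrite polyC0 subr0 in iX.
rewrite -eqp_monic ?monicX //; apply: iX => //.
by case: fir => f1 _; rewrite neq_ltn f1 orbT.
Qed.

Lemma card_residue : #|E| = (q ^ d)%N. Proof. exact: card_qfpoly. Qed.

Lemma dvd_Xn_sub1 n : (f %| 'X^n - 1) = (qx ^+ n == 1).
Proof. by rewrite -in_qpoly_eq0 rmorphB rmorphXn rmorph1 subr_eq0. Qed.

Lemma residue_exp_card1 (x : E) : x != 0 -> x ^+ (q ^ d).-1 = 1.
Proof.
move=> x0; apply: (mulfI x0); rewrite -exprS prednK ?mulr1 -?card_residue ?expf_card //.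
by rewrite (cardD1 0) inE.
Qed.

(** The Frobenius map has order dividing d on the field with q^d elements. *)
Lemma residue_expq k (x : E) : x ^+ (q ^ (d * k)) = x.
Proof.
elim: k => [|k IHk]; first by rewrite muln0 expr1.
by rewrite mulnS expnD exprM -card_residue expf_card IHk.
Qed.

(** Raising to the power q^m is a morphism of F-algebras, so it is the identity
    as soon as it fixes the generator. *)
Lemma expq_fix m : qx ^+ (q ^ m) = qx -> forall x : E, x ^+ (q ^ m) = x.
Proof.
move=> xm x.
have N : [pchar E].-nat (q ^ m)%N.
  rewrite pnatX (eq_pnat _ (pchar_qpoly f)).
  by rewrite pchar_nat_card.
have -> : x = in_qpoly f (val x).
  exact/val_inj/esym/in_qpoly_small/size_mk_monic.
elim/poly_ind: (val x) => [|p c IHp].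
  by rewrite rmorph0 expr0n expn_eq0 gtn_eqF // ltnW // finNzRing_gt1.
rewrite rmorphD rmorphM (exprDn_pchar _ _ N) exprMn IHp -/qx xm; congr (_ + _).
rewrite -rmorphXn -polyC_exp; congr (in_qpoly f _%:P).
by elim: m {xm N IHp} => // m IHm; rewrite expnS exprM expf_card.
Qed.

(** Both sides say that raising to the power q^m is the identity on F[X]/(f).
    If it is, so is raising to the power q^r with r the remainder of m modulo
    d; for 0 < r < d the polynomial X^(q^r) - X would have too many roots. *)
Lemma deg_dvd m : (d %| m)%N = (f %| 'X^((q ^ m).-1) - 1).
Proof.
rewrite dvd_Xn_sub1; have q1 := finNzRing_gt1 F.
have H : (qx ^+ (q ^ m).-1 == 1) = (qx ^+ (q ^ m) == qx).
  rewrite -[in RHS](@prednK (q ^ m)) ?expn_gt0 ?(ltnW q1) //.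
  by rewrite exprS -[X in _ = (_ == X)]mulr1 (inj_eq (mulfI qx_neq0)).
rewrite H; apply/idP/eqP => [/dvdnP[k ->]|/expq_fix xm].
  by rewrite mulnC residue_expq.
rewrite /dvdn; set r := (m %% d)%N.
have xr (x : E) : x ^+ (q ^ r) = x.
  have := xm x; rewrite {1}(divn_eq m d) expnD exprM mulnC residue_expq //.
have rd : (r < d)%N by rewrite ltn_mod deg_gt0.
rewrite -leqn0 leqNgt; apply/negP => r0.
have qr1 : (1 < q ^ r)%N by rewrite -(exp1n r) ltn_exp2r.
pose P : {poly E} := 'X^(q ^ r) - 'X.
have sP : size P = (q ^ r).+1.
  by rewrite /P size_polyDl ?size_polyXn // size_polyN size_polyX ltnS.
have P0 : P != 0 by rewrite -size_poly_gt0 sP.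
have := max_poly_roots P0 _ (enum_uniq E).
rewrite sP -cardE card_residue => H2.
have /H2 : all (root P) (enum E).
  by apply/allP => x _; rewrite rootE !hornerE xr subrr.
by rewrite ltnS leq_exp2l // leqNgt rd.
Qed.

Variable M : nat.
Hypothesis Mp : prime M.

Definition root_is_power := [exists b : {poly %/ f}, b ^+ M == in_qpoly f 'X].

Lemma root_is_powerP : reflect (exists b : E, b ^+ M = qx) root_is_power.
Proof. by apply: (iffP existsP) => -[b /eqP]; exists b => //; apply/eqP. Qed.

(** Euler's criterion, by cyclicity of the unit group: if M does not divide
    its order, then every unit is an M-th power, and otherwise the M-th powers
    are the units killed by the exponent order / M. *)
Lemma nonpower_euler : ~~ root_is_power ->
  (M %| (q ^ d).-1)%N /\ qx ^+ ((q ^ d).-1 %/ M) != 1.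
Proof.
set N := (q ^ d).-1; have N0 : (0 < N)%N.
  by rewrite /N -subn1 subn_gt0 -(exp1n d) ltn_exp2r ?deg_gt0 // finNzRing_gt1.
move=> np; have MN : (M %| N)%N.
  apply: contraR np => nMN; apply/root_is_powerP.
  have [u v uv _] := egcdnP N (prime_gt0 Mp).
  have co : coprime M N by rewrite prime_coprime.
  exists (qx ^+ u); rewrite -exprM uv (eqP (co : gcdn M N == 1%N)).
  by rewrite exprD mulnC exprM residue_exp_card1 ?qx_neq0 // expr1n mul1r expr1.
split=> //; apply: contraNneq np => xN1; apply/root_is_powerP.
have /cyclicP[g Eg] := field_unit_group_cyclic [set: {unit E}]%G.
have Ux : qx \is a GRing.unit by rewrite unitfE qx_neq0.
have : FinRing.unit E Ux \in <[g]>%g by rewrite -Eg inE.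
case/cycleP => k xk; have {xk} xk : qx = (FinRing.uval g) ^+ k.
  by rewrite -FinRing.val_unitX -xk.
have og : #[g]%g = N.
  rewrite orderE -Eg card_finField_unit; by rewrite card_residue.
have : (N %| k * (N %/ M))%N.
  rewrite -{1}og order_dvdn; apply/eqP/val_inj.
  by rewrite FinRing.val_unitX /= exprM -xk xN1.
rewrite -{1}(divnK MN) mulnC dvdn_pmul2r; last first.
  by rewrite divn_gt0 ?prime_gt0 // dvdn_leq.
by case/dvdnP => j kj; exists ((FinRing.uval g) ^+ j); rewrite -exprM -kj -xk.
Qed.

Lemma geom_mod k : (M %| (q ^ d).-1)%N ->
  ((q ^ (d * k)).-1 %/ M)%N = ((q ^ d).-1 %/ M * (\sum_(i < k) (q ^ d) ^ i))%N.
Proof. by move=> MN; rewrite expnM predn_exp mulnC -muln_divA // mulnC. Qed.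

(** The exponent (q^(dk) - 1) / (q^d - 1) of the norm, modulo M. *)
Lemma geom_sum_mod k : (M %| (q ^ d).-1)%N ->
  (\sum_(i < k) (q ^ d) ^ i = k %[mod M])%N.
Proof.
move=> MN; have E1 : (q ^ d = 1 %[mod M])%N.
  have qd : (0 < q ^ d)%N by rewrite expn_gt0 ltnW // finNzRing_gt1.
  by apply/eqP; rewrite eqn_mod_dvd // subn1.
rewrite -modn_summ; under eq_bigr => i _ do rewrite -modnXm E1 modnXm exp1n.
by rewrite modn_summ sum_nat_const card_ord muln1.
Qed.

(** By Euler's criterion, the left-hand side says that the root x of f is not
    an M-th power in a field with q^m elements.  With N = q^d - 1, the
    exponent (q^m - 1) / M is N / M times a number congruent to m / d modulo
    M, and x^(N / M) is a primitive M-th root of unity if x is not an M-th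
    power in F[X]/(f). *)
Lemma nonpower_extension m : (d %| m)%N -> (M %| (q ^ m).-1)%N ->
  (~~ (f %| 'X^((q ^ m).-1 %/ M) - 1)) = ~~ root_is_power && ~~ (M * d %| m)%N.
Proof.
case/dvdnP => k -> MN; rewrite dvd_Xn_sub1.
have [/root_is_powerP[b bx]|np] := boolP root_is_power.
  rewrite -bx -exprM mulnC divnK //; apply/negbF/eqP.
  have b0 : b != 0.
    by apply/eqP => b0; have := qx_neq0;
      rewrite -bx b0 expr0n gtn_eqF ?prime_gt0 // eqxx.
  rewrite mulnC expnM predn_exp exprM residue_exp_card1 ?expr1n //.
have [Md zeta1] := nonpower_euler np.
rewrite /= (mulnC k) (mulnC M) geom_mod // exprM; set z := qx ^+ _ in zeta1 *.
have zM : z ^+ M = 1 by rewrite -exprM divnK // residue_exp_card1 ?qx_neq0.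
rewrite dvdn_pmul2l ?deg_gt0 //; congr (~~ _).
have zp : M.-primitive_root z.
  have [j zj jM] := prim_order_exists (prime_gt0 Mp) zM.
  have [_ /(_ j jM)] := primeP Mp; case/orP => /eqP Ej; last by rewrite -Ej.
  by move: zj zeta1; rewrite Ej => /prim_expr_order; rewrite expr1 => ->; rewrite eqxx.
rewrite -(prim_order_dvd zp) /dvdn geom_sum_mod //.
Qed.
End OneFactor.
End FiniteField.

(** * Degree sums over irreducible polynomials *)

Section Count.
Variables (F : finFieldType) (M N : nat).
Hypothesis Mp : prime M.
Notation q := #|F|.
Local Notation P := {poly_N F}.
Implicit Type f : P.

Definition deg (f : {poly F}) := (size f).-1.

(** The total degree of one block of f: an f whose root is not an M-th power
    only occurs in M copies at a time. *)
Definition wdeg (f : {poly F}) := (if root_is_power f M then deg f else M * deg f)%N.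

(** Counts the nonzero x in the field with q^m elements that are not M-th
    powers in the subfield F(x), provided that N exceeds m: each f contributes
    its deg f roots. *)
Definition nonpower_degs m :=
  (\sum_(f : P | [&& irr_notX f, ~~ root_is_power f M & deg f %| m]) deg f)%N.

(** The number of units of the field with q^m elements that are not M-th
    powers in that field. *)
Definition new_nonpowers m :=
  (if M %| (q ^ m).-1 then (q ^ m).-1 - (q ^ m).-1 %/ M else 0)%N.

Lemma natr_neq0_dvd k m : (0 < m)%N -> (k %| (q ^ m).-1)%N -> k%:R != 0 :> F.
Proof.
move=> m0 /dvdnP[j E]; apply/eqP => k0.
have : (q ^ m).-1.+1%:R = 0 :> F.
  by rewrite prednK ?expn_gt0 ?(ltnW (finNzRing_gt1 F)) // natrX card_natr0 expr0n
    gtn_eqF.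
by rewrite -natr1 E natrM k0 mulr0 add0r => /eqP; rewrite oner_eq0.
Qed.

(** X^k - 1 is separable for such k, and X is not one of its factors. *)
Lemma sum_deg_Xn_sub1 m k : (0 < m)%N -> (0 < k)%N -> (k %| (q ^ m).-1)%N ->
  (q ^ m <= N)%N ->
  (\sum_(f : P | irr_notX f && ((f : {poly F}) %| 'X^k - 1)%R) deg f = k)%N.
Proof.
move=> m0 k0 kd mN; have sk : size ('X^k - 1 : {poly F}) = k.+1 by rewrite size_XnsubC.
have kq : (k.+1 <= q ^ m)%N.
  rewrite -(@prednK (q ^ m)) ?expn_gt0 ?(ltnW (finNzRing_gt1 F)) // ltnS dvdn_leq //.
  by rewrite -subn1 subn_gt0 -(exp1n m) ltn_exp2r ?finNzRing_gt1.
transitivity (size ('X^k - 1 : {poly F})).-1; last by rewrite sk.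
rewrite -(@sum_deg_factors F N ('X^k - 1)).
- apply: eq_bigl => f; have [fk|] := boolP (_ %| _); last by rewrite !andbF.
  rewrite !andbT; apply/irr_notXP/asboolP => -[] // fm fi; split=> //.
  apply: contraTneq fk => ->; rewrite -{1}['X]subr0 -polyC0 dvdp_XsubCl rootE.
  by rewrite hornerD hornerN hornerXn hornerC expr0n gtn_eqF // sub0r oppr_eq0 oner_eq0.
- exact/separable_Xn_sub_1/(natr_neq0_dvd m0).
- exact: monicXnsubC.
by rewrite sk (leq_trans kq).
Qed.

Lemma predn_expq_gt0 m : (0 < m)%N -> (0 < (q ^ m).-1)%N.
Proof. by move=> m0; rewrite -subn1 subn_gt0 -(exp1n m) ltn_exp2r ?finNzRing_gt1. Qed.

(** The f in the sum are the factors of X^(q^m - 1) - 1. *)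
Lemma sum_deg_dvd m : (0 < m)%N -> (q ^ m <= N)%N ->
  (\sum_(f : P | irr_notX f && (deg f %| m)) deg f = (q ^ m).-1)%N.
Proof.
move=> m0 mN; rewrite -[RHS](sum_deg_Xn_sub1 m0 (predn_expq_gt0 m0)) //.
by apply: eq_bigl => f; apply: andb_id2l => fi; rewrite deg_dvd.
Qed.

Lemma nonpower_degs_divM m : (M %| m)%N ->
  nonpower_degs (m %/ M) =
  (\sum_(f : P | [&& irr_notX f, ~~ root_is_power f M & M * deg f %| m]) deg f)%N.
Proof.
move=> Mm; apply: eq_bigl => f; congr [&& _, _ & _].
by rewrite -{2}(divnK Mm) mulnC dvdn_pmul2r ?prime_gt0.
Qed.

Lemma sum_nonpower_mulM m :
  (\sum_(f : P | [&& irr_notX f, ~~ root_is_power f M & M * deg f %| m]) deg f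
   = if M %| m then nonpower_degs (m %/ M) else 0)%N.
Proof.
case: ifP => Mm; first by rewrite nonpower_degs_divM.
rewrite big_pred0 // => f; apply/negP => /and3P[_ _].
by move=> /(dvdn_trans (dvdn_mulr _ (dvdnn M))); rewrite Mm.
Qed.

(** The roots counted on the left that are not M-th powers in the field with
    q^m elements form the first term: they are the roots of X^(q^m - 1) - 1
    that are not roots of X^((q^m - 1) / M) - 1.  By [nonpower_extension] the
    others have M * deg f | m. *)
Lemma nonpower_degs_rec m : (0 < m)%N -> (q ^ m <= N)%N ->
  nonpower_degs m = (new_nonpowers m + if M %| m then nonpower_degs (m %/ M) else 0)%N.
Proof.
move=> m0 mN; rewrite -sum_nonpower_mulM /new_nonpowers.
have dM (f : P) : (M * deg f %| m)%N -> (deg f %| m)%N by apply/dvdn_trans/dvdn_mull.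
rewrite /nonpower_degs (bigID (fun f : P => M * deg f %| m)%N) /= addnC;
  congr (_ + _)%N; last first.
  apply: eq_bigl => f; rewrite -!andbA.
  by do 2![apply: andb_id2l => _]; apply: andb_idl; exact: dM.
case: ifP => [Mq|Mq]; last first.
  rewrite big1 // => f /andP[/and3P[fi np fm] _].
  have [Md _] := nonpower_euler fi Mp np.
  move: Mq; case/dvdnP: fm => k ->; rewrite mulnC expnM.
  by rewrite (dvdn_trans Md (dvdn_pred_predX _ _)).
have kM : ((q ^ m).-1 %/ M %| (q ^ m).-1)%N by rewrite -{2}(divnK Mq) dvdn_mulr.
have k0 : (0 < (q ^ m).-1 %/ M)%N.
  by rewrite divn_gt0 ?prime_gt0 // dvdn_leq // predn_expq_gt0.
rewrite -(sum_deg_Xn_sub1 m0 k0 kM mN) -{1}(sum_deg_dvd m0 mN).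
pose kdvd (f : P) := (f : {poly F}) %| 'X^((q ^ m).-1 %/ M) - 1.
rewrite [X in _ = (X - _)%N](bigID kdvd) /= /kdvd.
have -> : (\sum_(f : P | (irr_notX f && (deg f %| m)) && kdvd f) deg f
  = \sum_(f : P | irr_notX f && kdvd f) deg f)%N.
  apply: eq_bigl => f; rewrite -andbA; apply: andb_id2l => fi.
  rewrite /kdvd andb_idl // deg_dvd // !dvd_Xn_sub1 // => /eqP x1.
  by rewrite -(divnK kM) mulnC exprM x1 expr1n.
rewrite addKn; apply: eq_bigl => f; rewrite -!andbA; apply: andb_id2l => fi.
by rewrite [LHS]andbCA; apply: andb_id2l => fm; rewrite (nonpower_extension fi Mp).
Qed.

(** The sum of w(f) is the coefficient of u^m in the logarithmic derivative of
    the product of the 1 / (1 - u^w(f)).  It differs from the sum over all f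
    of the degrees only in the terms with a nonpower root. *)
Lemma wdeg_sum m : (0 < m)%N -> (q ^ m <= N)%N ->
  (\sum_(f : P | irr_notX f && (wdeg f %| m)) wdeg f + nonpower_degs m
   = (q ^ m).-1 + if M %| m then M * nonpower_degs (m %/ M) else 0)%N.
Proof.
move=> m0 mN; rewrite -(sum_deg_dvd m0 mN).
rewrite (bigID (fun f : P => root_is_power f M)).
rewrite [X in _ = (X + _)%N](bigID (fun f : P => root_is_power f M)) /=.
rewrite -!addnA; congr (_ + _)%N.
  apply: eq_big => [f|f /andP[_]]; rewrite /wdeg; last by move=> ->.
  by rewrite -!andbA; case: (root_is_power f M); rewrite ?andbF ?andbT.
rewrite addnC; congr (_ + _)%N.
  by apply: eq_bigl => f; rewrite -!andbA; case: root_is_power; rewrite ?andbF ?andbT.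
transitivity (\sum_(f : P | [&& irr_notX f, ~~ root_is_power f M & M * deg f %| m])
  M * deg f)%N.
  apply: eq_big => [f|f /andP[_ /negPf]]; rewrite /wdeg; last by move=> ->.
  by rewrite -!andbA; case: (root_is_power f M); rewrite ?andbF ?andbT.
by rewrite -big_distrr sum_nonpower_mulM /=; case: ifP; rewrite ?muln0.
Qed.
End Count.

(** * Decompositions of matrices into simple modules *)

Lemma mx_of_linear (R : comNzRingType) m n (g : 'cV[R]_n -> 'cV[R]_m) :
  {morph g : u v / u + v} -> (forall c u, g (c *: u) = c *: g u) ->
  exists B : 'M[R]_(m, n), forall v, B *m v = g v.
Proof.
move=> gD gZ; have g0 : g 0 = 0 by rewrite -(scale0r 0) gZ scale0r.
exists (\matrix_(i, j) g (delta_mx j 0) i 0) => v.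
rewrite {2}[v]matrix_sum_delta; under eq_bigr do rewrite big_ord1.
rewrite (big_morph g gD g0); apply/colP => i; rewrite !mxE summxE.
by apply: eq_bigr => j _; rewrite gZ !mxE mulrC.
Qed.

Section Modules.
Variable F : finFieldType.
Notation q := #|F|.

(** Families over different quotient rings carry no module structure here;
    linearity is therefore expressed one component at a time. *)
Definition qprod (I : finType) (f : I -> {poly F}) := {dffun forall i, {poly %/ f i}}.

Definition coord_linear n (I : finType) (f : I -> {poly F})
    (phi : 'cV[F]_n -> qprod f) :=
  (forall u v i, phi (u + v) i = phi u i + phi v i) /\
  (forall c u i, phi (c *: u) i = c *: phi u i).

(** Relational, with w'' in the role of w + w' or of c w. *)
Definition qprod_linear (I J : finType) (f : I -> {poly F}) (g : J -> {poly F})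
    (T : qprod f -> qprod g) :=
  (forall w w' w'' : qprod f, (forall i, w'' i = w i + w' i) ->
     forall j, T w'' j = T w j + T w' j) /\
  (forall c (w w'' : qprod f), (forall i, w'' i = c *: w i) ->
     forall j, T w'' j = c *: T w j).

(** Through bijective linear coordinates every linear map of families is given
    by a matrix; this produces A, its roots and the conjugating matrices. *)
Lemma mx_of_map n (I J : finType) (f : I -> {poly F}) (g : J -> {poly F})
    (phi : 'cV[F]_n -> qprod f) (chi : 'cV[F]_n -> qprod g) (T : qprod f -> qprod g) :
  coord_linear phi -> coord_linear chi -> bijective chi -> qprod_linear T ->
  exists B : 'M[F]_n, forall v, chi (B *m v) = T (phi v).
Proof.
move=> [phiD phiZ] [chiD chiZ] [psi chiK psiK] [TD TZ].
have [||B HB] := @mx_of_linear F n n (fun v => psi (T (phi v))).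
- move=> u v; apply: (can_inj chiK); apply/ffunP => j; rewrite chiD !psiK.
  by apply: TD => i; rewrite phiD.
- move=> c u; apply: (can_inj chiK); apply/ffunP => j; rewrite chiZ !psiK.
  by apply: TZ => i; rewrite phiZ.
by exists B => v; rewrite HB psiK.
Qed.

Lemma in_qpolyCz (h : {poly F}) c (y : {poly %/ h}) : in_qpoly h c%:P * y = c *: y.
Proof. by rewrite -alg_polyC in_qpolyZ in_qpoly1 -scalerAl mul1r. Qed.

Lemma in_qpoly_val (h : {poly F}) (y : {poly %/ h}) : in_qpoly h (val y) = y.
Proof. exact/val_inj/in_qpoly_small/size_mk_monic. Qed.

Lemma in_qpoly_castM (f g : {poly F}) (a b : {poly %/ f}) : f = g ->
  in_qpoly g (val (a * b)) = in_qpoly g (val a) * in_qpoly g (val b).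
Proof. by move=> fg; case: g / fg; rewrite !in_qpoly_val. Qed.

Lemma in_qpoly_cast (f g p : {poly F}) : f = g ->
  in_qpoly g (val (in_qpoly f p)) = in_qpoly g p.
Proof. by move=> fg; case: g / fg; rewrite in_qpoly_val. Qed.

(** The data of [semisimple_mx], for summands indexed by any finite type, so
    that sigma types can be used as indices. *)
Definition decomposes n (A : 'M[F]_n.+1) (I : finType) (f : I -> {poly F})
    (phi : 'cV[F]_n.+1 -> qprod f) :=
  [/\ bijective phi, forall u v i, phi (u + v) i = phi u i + phi v i
    & forall p v i, phi (horner_mx A p *m v) i = in_qpoly (f i) p * phi v i].

Lemma decomposes_linear n (A : 'M[F]_n.+1) (I : finType) (f : I -> {poly F})
  (phi : 'cV[F]_n.+1 -> qprod f) : decomposes A phi -> coord_linear phi.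
Proof.
case=> _ phiD phiA; split=> // c u i.
by rewrite -in_qpolyCz -phiA horner_mx_C mul_scalar_mx.
Qed.

(** X and the scalars generate F[X]. *)
Lemma decomposes_from_X n (A : 'M[F]_n.+1) (I : finType) (f : I -> {poly F})
    (phi : 'cV[F]_n.+1 -> qprod f) :
  bijective phi -> coord_linear phi ->
  (forall v i, phi (A *m v) i = in_qpoly (f i) 'X * phi v i) -> decomposes A phi.
Proof.
move=> phiB [phiD phiZ] phiX; split=> // p v i; elim/poly_ind: p v => [|p c IHp] v.
  by rewrite rmorph0 mul0mx rmorph0 mul0r -(scale0r 0) phiZ scale0r.
rewrite !rmorphD !rmorphM /= horner_mx_C horner_mx_X mulmxDl phiD mul_scalar_mx phiZ.
by rewrite -mulmxA IHp phiX !mulrDl mulrA in_qpolyCz.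
Qed.

Lemma mk_monic_irr (h : {poly F}) : irr_notX h -> mk_monic h = h.
Proof. by move=> hi; apply: mk_monicE; apply: (irr_notX_mi hi). Qed.

Lemma card_irr_qpoly (h : {poly F}) :
  irr_notX h -> #|{poly %/ h}| = (q ^ (size h).-1)%N.
Proof. by move=> hi; rewrite card_qpoly mk_monic_irr. Qed.

(** Both sides are logarithms in base q of the number of vectors. *)
Lemma decomposes_dim n (A : 'M[F]_n.+1) (I : finType) (f : I -> {poly F})
    (phi : 'cV[F]_n.+1 -> qprod f) :
  (forall i, irr_notX (f i)) -> decomposes A phi -> (\sum_i (size (f i)).-1 = n.+1)%N.
Proof.
move=> fi [phiB _ _]; apply: (@expnI q); first exact: finNzRing_gt1.
have := bij_eq_card phiB; rewrite card_mx muln1 => ->.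
rewrite card_dep_ffun foldrE big_map big_enum /= expn_sum.
by apply: eq_bigr => i _; rewrite card_irr_qpoly.
Qed.

(** The coordinates are the coefficients of all the residues, which are as
    many as pairs of an index i and an exponent below the degree of f i. *)
Lemma qprod_coord n (I : finType) (f : I -> {poly F}) :
  (forall i, irr_notX (f i)) -> (\sum_i (size (f i)).-1 = n)%N ->
  exists phi : 'cV[F]_n -> qprod f, bijective phi /\ coord_linear phi.
Proof.
move=> fi sum_n; pose d i := (size (f i)).-1.
pose S := {i : I & 'I_(d i)}.
have cS : #|{: S}| = n.
  rewrite card_tagged -sum_n sumnE big_map big_enum /=.
  by apply: eq_bigr => i _; rewrite card_ord.
(* e and e' number the pairs of a summand and an exponent. *)
pose e (s : S) : 'I_n := cast_ord cS (enum_rank s).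
pose e' (a : 'I_n) : S := enum_val (cast_ord (esym cS) a).
have eK : cancel e e' by move=> s; rewrite /e /e' cast_ordK enum_rankK.
have e'K : cancel e' e by move=> a; rewrite /e /e' enum_valK cast_ordKV.
have sz i (y : {poly %/ f i}) : (size (val y) <= d i)%N.
  apply: leq_trans (size_npoly y) _; by rewrite mk_monic_irr.
pose phi (v : 'cV[F]_n) : qprod f :=
  [ffun i => in_qpoly (f i) (rVpoly (\row_(j < d i) v (e (Tagged _ j)) 0))].
pose psi (w : qprod f) : 'cV[F]_n :=
  \col_a (poly_rV (val (w (tag (e' a)))) : 'rV_(d (tag (e' a)))) 0 (tagged (e' a)).
exists phi; split; last first.
  split=> [u v i|c u i]; rewrite !ffunE.
    by rewrite -rmorphD -raddfD; congr (in_qpoly _ (rVpoly _)); apply/rowP => j;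
      rewrite !mxE.
  by rewrite -in_qpolyZ -linearZ; congr (in_qpoly _ (rVpoly _)); apply/rowP => j;
    rewrite !mxE.
have phiE v i : val (phi v i) = rVpoly (\row_(j < d i) v (e (Tagged _ j)) 0).
  rewrite ffunE; apply: in_qpoly_small.
  rewrite mk_monic_irr // (leq_ltn_trans (size_poly _ _)) // /d prednK //.
  by have [_ [f1 _] _] := irr_notXP _ (fi i); rewrite ltnW.
exists psi => [v|w].
  apply/colP => a; rewrite mxE phiE rVpolyK mxE.
  by rewrite -[RHS](f_equal (fun b => v b 0) (e'K a)); case: (e' a).
apply/ffunP => i; rewrite ffunE.
have -> : \row_(j < d i) psi w (e (Tagged (fun i => 'I_(d i)) j)) 0
  = poly_rV (val (w i)).
  by apply/rowP => j; rewrite !mxE eK /=.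
by rewrite poly_rV_K ?sz // in_qpoly_val.
Qed.

Lemma qprod_linear_in_qpoly (I : finType) (f : I -> {poly F}) p :
  qprod_linear (fun w : qprod f => [ffun i => in_qpoly (f i) p * w i] : qprod f).
Proof.
split=> [w w' w'' E j|c w w'' E j]; rewrite !ffunE E ?mulrDr //.
by rewrite -scalerAr.
Qed.

Lemma exists_decomposes n (I : finType) (f : I -> {poly F}) :
  (forall i, irr_notX (f i)) -> (\sum_i (size (f i)).-1 = n.+1)%N ->
  exists (A : 'M[F]_n.+1) (phi : 'cV[F]_n.+1 -> qprod f), decomposes A phi.
Proof.
move=> fi /(qprod_coord fi)[phi [phiB phiL]].
have [A HA] := mx_of_map phiL phiL phiB (qprod_linear_in_qpoly f 'X).
by exists A, phi; apply: decomposes_from_X => // v i; rewrite HA ffunE.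
Qed.

Lemma unitmx_inj n (P : 'M[F]_n) : (forall v : 'cV_n, P *m v = 0 -> v = 0) ->
  P \in unitmx.
Proof.
move=> H; rewrite -unitmx_tr -row_free_unit; apply: inj_row_free => v vP.
by apply: trmx_inj; rewrite trmx0; apply: H; rewrite -[P]trmxK -trmx_mul vP trmx0.
Qed.

Lemma coord_linear0 n (I : finType) (f : I -> {poly F}) (phi : 'cV[F]_n -> qprod f) i :
  coord_linear phi -> phi 0 i = 0.
Proof. by case=> _ phiZ; rewrite -(scale0r 0) phiZ scale0r. Qed.

(** X acts invertibly on F[X]/(f) for irreducible f <> X. *)
Lemma decomposes_unit n (A : 'M[F]_n.+1) (I : finType) (f : I -> {poly F})
    (phi : 'cV[F]_n.+1 -> qprod f) :
  (forall i, irr_notX (f i)) -> decomposes A phi -> A \in unitmx.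
Proof.
move=> fi Ad; have phiL := decomposes_linear Ad; have [phiB _ phiA] := Ad.
apply: unitmx_inj => v Av; apply: (bij_inj phiB); apply/ffunP => i.
have := phiA 'X v i; rewrite horner_mx_X Av !(coord_linear0 _ phiL) => /esym/eqP.
have := @mulf_eq0 {poly %/ f i with irr_notX_mi (fi i)} (in_qpoly (f i) 'X) (phi v i).
by move=> ->; rewrite (negPf (qx_neq0 (fi i))) => /eqP.
Qed.

(** Reindexing the summands by s is an isomorphism of F[X]-modules, and the
    matrix of such an isomorphism conjugates A to B.  Residues are transported
    along f (s j) = g j through their polynomial representatives. *)
Lemma decomposes_conj n (A B : 'M[F]_n.+1) (I J : finType) (f : I -> {poly F})
    (g : J -> {poly F}) (phi : 'cV[F]_n.+1 -> qprod f) (chi : 'cV[F]_n.+1 -> qprod g)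
    (s : J -> I) :
  decomposes A phi -> decomposes B chi -> bijective s -> (forall j, f (s j) = g j) ->
  exists2 P : 'M[F]_n.+1, P \in unitmx & P *m A = B *m P.
Proof.
move=> Ad Bd [s' sK s'K] fg.
have phiL := decomposes_linear Ad; have chiL := decomposes_linear Bd.
have [phiB phiD phiA] := Ad; have [chiB chiD chiA] := Bd.
pose T (w : qprod f) : qprod g := [ffun j => in_qpoly (g j) (val (w (s j)))].
have TL : qprod_linear T.
  split=> [w w' w'' E j|c w w'' E j]; rewrite !ffunE E; first exact: in_qpolyD.
  exact: in_qpolyZ.
have [P HP] := mx_of_map phiL chiL chiB TL.
exists P.
  apply: unitmx_inj => v Pv; apply: (bij_inj phiB); apply/ffunP => i.
  suff H j : phi v (s j) = phi 0 (s j) by have := H (s' i); rewrite s'K.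
  have := congr1 (fun w : qprod g => w j) (HP v).
  rewrite Pv (coord_linear0 _ phiL) (coord_linear0 _ chiL) ffunE;
    case: (g j) / (fg j) => E.
  by rewrite -[LHS]in_qpoly_val -E.
have H (v : 'cV_n.+1) : P *m A *m v = B *m P *m v.
  apply: (bij_inj chiB); apply/ffunP => j.
  rewrite -!mulmxA HP ffunE -{1}[A]horner_mx_X phiA -{1}[B]horner_mx_X chiA HP ffunE.
  by rewrite in_qpoly_castM ?fg // in_qpoly_cast ?fg.
apply/matrixP => i j; have := congr1 (fun M : 'cV_n.+1 => M i 0) (H (delta_mx j 0)).
by rewrite -!colE !mxE.
Qed.

(** On a summand F[X]/(h) the action of h is zero; on a summand F[X]/(f i)
    with f i <> h it is invertible.  This makes the multiplicity of h a
    conjugacy invariant. *)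
Lemma card_ker n (A : 'M[F]_n.+1) (I : finType) (f : I -> {poly F})
    (phi : 'cV[F]_n.+1 -> qprod f) (h : {poly F}) :
  (forall i, irr_notX (f i)) -> irr_notX h -> decomposes A phi ->
  #|[set v : 'cV_n.+1 | horner_mx A h *m v == 0]|
  = (q ^ ((size h).-1 * #|[pred i | f i == h]|))%N.
Proof.
move=> fi hi Ad; have phiL := decomposes_linear Ad; have [phiB phiD phiA] := Ad.
rewrite -(card_imset _ (bij_inj phiB)).
have -> : #|phi @: [set v : 'cV_n.+1 | horner_mx A h *m v == 0]|
    = #|(family (fun i => [pred y : {poly %/ f i} | in_qpoly (f i) h * y == 0])
        : simpl_pred (qprod f))|.
  apply: eq_card => w; have [psi phiK psiK] := phiB.
  apply/imsetP/familyP => [[v]|H].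
    rewrite inE => /eqP hv -> i; rewrite inE /= -phiA hv (coord_linear0 _ phiL) //.
  exists (psi w); rewrite ?psiK // inE; apply/eqP/(bij_inj phiB)/ffunP => i.
  by rewrite phiA psiK (coord_linear0 _ phiL); apply/eqP/H.
rewrite card_family foldrE big_map big_enum /= expnM -prod_nat_const.
rewrite [RHS]big_mkcond; apply: eq_bigr => i _; rewrite inE /=.
have [E|nE] := eqVneq (f i) h.
  rewrite -E -(card_irr_qpoly (fi i)); apply: eq_card => y; rewrite !inE.
  have -> : in_qpoly (f i) (f i) = 0 :> {poly %/ f i}.
    by apply/eqP; rewrite (in_qpoly_eq0 (fi i)).
  by rewrite unfold_in mul0r eqxx.
rewrite (eq_card (B := pred1 0)) ?card1 // => y; rewrite inE unfold_in.
rewrite (@mulf_eq0 {poly %/ f i with irr_notX_mi (fi i)} (in_qpoly (f i) h) y).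
have [hm hir _] := irr_notXP _ hi; have [fm fir _] := irr_notXP _ (fi i).
by rewrite (in_qpoly_eq0 (fi i)) irr_eqp // (negPf nE).
Qed.
End Modules.

(** * M-th roots of semisimple matrices *)

Section Roots.
Variable F : finFieldType.
Variable M : nat.
Hypothesis Mp : prime M.
Notation q := #|F|.

(** Let E = F[X]/(h), with x the residue of X, and let r be the multiplicity of
    h.  Since Y commutes with A, it acts E-linearly on the kernel of h(A),
    which is E^r, and Y^M = A acts there as the scalar x.  Taking determinants,
    det(Y)^M = x^r; if r were prime to M, then x would be an M-th power. *)
Lemma nonpower_multiplicity n (A Y : 'M[F]_n.+1) (I : finType) (f : I -> {poly F})
    (phi : 'cV[F]_n.+1 -> qprod f) (h : {poly F}) :
  (forall i, irr_notX (f i)) -> irr_notX h -> decomposes A phi -> Y ^+ M = A ->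
  ~~ root_is_power h M -> (M %| #|[pred i | f i == h]|)%N.
Proof.
move=> fi hi Ad YM np; have phiL := decomposes_linear Ad; have [phiB phiD phiA] := Ad.
have [phi' phiK phi'K] := phiB.
set K := [pred i | f i == h]; set r := #|K|.
pose E := {poly %/ h}.
have ev (k : 'I_r) : f (enum_val k) = h by have := enum_valP k; rewrite inE => /eqP.
(* psi projects onto the summands equal to F[Y]/(h), and s is the inclusion of
   their sum; both are compatible with the action of polynomials. *)
pose psi (v : 'cV[F]_n.+1) : 'cV[E]_r := \col_k in_qpoly h (val (phi v (enum_val k))).
pose s (w : 'cV[E]_r) : 'cV[F]_n.+1 :=
  phi' [ffun i => in_qpoly (f i) (val (\sum_(k | enum_val k == i) w k 0))].
have psiD : {morph psi : u v / u + v}.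
  by move=> u v; apply/colP => k; rewrite !mxE phiD in_qpolyD.
have psiA p v : psi (horner_mx A p *m v) = in_qpoly h p *: psi v.
  apply/colP => k; rewrite !mxE phiA in_qpoly_castM ?ev //.
  by rewrite in_qpoly_cast ?ev.
have sD : {morph s : u v / u + v}.
  move=> u v; apply: (bij_inj phiB); apply/ffunP => i; rewrite phiD !phi'K !ffunE.
  rewrite -in_qpolyD; congr (in_qpoly _ _).
  by rewrite -poly_of_qpolyD -big_split; congr (val _); apply: eq_bigr => k _;
    rewrite mxE.
have sA p w : s (in_qpoly h p *: w) = horner_mx A p *m s w.
  apply: (bij_inj phiB); apply/ffunP => i; rewrite phiA !phi'K !ffunE.
  have [k /eqP ki|nk] := pickP (fun k : 'I_r => enum_val k == i); last first.
    by rewrite !big_pred0 // rmorph0 mulr0.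
  have fh : f i = h by rewrite -ki ev.
  rewrite -[in_qpoly (f i) p](@in_qpoly_cast F h) // -in_qpoly_castM //.
  by rewrite mulr_sumr; congr (in_qpoly _ (val _)); apply: eq_bigr => j _; rewrite mxE.
have psis w : psi (s w) = w.
  apply/colP => k; rewrite mxE phi'K ffunE in_qpoly_cast ?ev //.
  rewrite (big_pred1 k) ?in_qpoly_val // => j.
  by rewrite (inj_eq enum_val_inj).
have hs w : horner_mx A h *m s w = 0.
  rewrite -sA.
  have -> : in_qpoly h h = 0 :> {poly %/ h} by apply/eqP; rewrite (in_qpoly_eq0 hi).
  rewrite scale0r; apply: (bij_inj phiB); apply/ffunP => i.
  rewrite phi'K ffunE (coord_linear0 _ phiL) big1 ?rmorph0 // => k _.
  by rewrite mxE.
have spsi u : horner_mx A h *m u = 0 -> s (psi u) = u.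
  move=> hu; apply: (bij_inj phiB); apply/ffunP => i; rewrite phi'K ffunE.
  have [fh|nfh] := eqVneq (f i) h.
    have iK : i \in K by rewrite inE fh.
    rewrite (big_pred1 (enum_rank_in iK i)); last first.
      by move=> k /=; apply/eqP/eqP => [ki|->]; [apply: enum_val_inj|];
        rewrite enum_rankK_in.
    by rewrite mxE enum_rankK_in // in_qpoly_cast ?in_qpoly_val.
  rewrite big_pred0; last by move=> k; apply/negP => /eqP ki;
    rewrite -ki ev eqxx in nfh.
  rewrite rmorph0; have := phiA h u i; rewrite hu (coord_linear0 _ phiL) => /esym/eqP.
  pose Ei := {poly %/ f i with irr_notX_mi (fi i)}.
  rewrite (@mulf_eq0 Ei (in_qpoly (f i) h) (phi u i)).
  have [hm hir _] := irr_notXP _ hi; have [fm fir _] := irr_notXP _ (fi i).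
  by rewrite (in_qpoly_eq0 (fi i)) irr_eqp // (negPf nfh) => /eqP.
(* The image of s is the kernel of h(A), and Y preserves it. *)
have YA : comm_mx Y A by rewrite -YM; exact: (commrX M (commr_refl Y)).
have Yh v p : Y *m (horner_mx A p *m v) = horner_mx A p *m (Y *m v).
  by rewrite !mulmxA (comm_mx_horner p YA).
have [||B HB] := @mx_of_linear E r r (fun w => psi (Y *m s w)).
- by move=> u v; rewrite sD mulmxDr psiD.
- by move=> e w; rewrite -[e]in_qpoly_val sA Yh psiA.
have it k : exists2 C : 'M[E]_r, \det C = \det B ^+ k
    & forall w, C *m w = psi (Y ^+ k *m s w).
  elim: k => [|k [C dC HC]].
    by exists 1%:M => [|w]; rewrite ?det1 // !mul1mx psis.
  exists (B *m C) => [|w]; first by rewrite det_mulmx dC exprS.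
  rewrite -mulmxA HC HB spsi; first by rewrite mulmxA exprS.
  have -> : horner_mx A h *m (Y ^+ k *m s w) = Y ^+ k *m (horner_mx A h *m s w).
    rewrite !mulmxA; congr (_ *m _).
    exact: (commrX k (commr_sym (comm_mx_horner h YA))).
  by rewrite hs mulmx0.
have [C dC HC] := it M.
have EC : C = (in_qpoly h 'X)%:M.
  apply/matrixP => i j; have := HC (delta_mx j 0).
  rewrite YM -{1}[A]horner_mx_X psiA psis -mul_scalar_mx.
  by move/colP/(_ i); rewrite -!colE !mxE.
apply: contraR np; rewrite -prime_coprime // => co.
move: dC; rewrite EC det_scalar => dX.
(* u * M = v * r + 1, so x = x^(u * M) / x^(v * r) = (x^u / det(B)^v)^M. *)
have [u v uv _] := egcdnP r (prime_gt0 Mp).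
pose xE : {poly %/ h with irr_notX_mi hi} := in_qpoly h 'X.
pose dE : {poly %/ h with irr_notX_mi hi} := \det B.
have dXE : xE ^+ r = dE ^+ M by exact: dX.
have xnz : xE != 0 := qx_neq0 hi.
have dnz : dE != 0.
  apply/eqP => d0; have : xE ^+ r != 0 by rewrite expf_neq0.
  by rewrite dXE d0 expr0n gtn_eqF ?prime_gt0 // eqxx.
apply/(root_is_powerP hi); exists ((xE ^+ u) / (dE ^+ v)).
rewrite expr_div_n -!exprM uv (eqP (co : gcdn M r == 1%N)) exprD (mulnC v r) exprM.
by rewrite dXE -exprM (mulnC M v) expr1 mulrAC divff ?mul1r // expf_neq0.
Qed.

(** The multiplicities of h in semisimple matrices that are M-th powers are the
    multiples of this number. *)
Definition min_mult (h : {poly F}) := if root_is_power h M then 1%N else M.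

Lemma min_mult_gt0 h : (0 < min_mult h)%N.
Proof. by rewrite /min_mult; case: ifP => // _; apply: prime_gt0. Qed.

Section Model.
Variables (J : finType) (g : J -> {poly F}).
Hypothesis gi : forall j, irr_notX (g j).
Let I := {j : J & 'I_(min_mult (g j))}.
Let f (i : I) := g (tag i).

(** Weights c of a cyclic shift of the copies of F[X]/(h) for which the product
    around the cycle is the residue of X: on a single copy the weight is an
    M-th root of it, on M copies one weight is X and the others are 1. *)
Lemma root_coef h : irr_notX h -> exists c : 'I_(min_mult h) -> {poly %/ h},
  forall a, \prod_(l < M) c (iter l (@ord_pred _) a) = in_qpoly h 'X
    /\ iter M (@ord_pred _) a = a.
Proof.
move=> hi; rewrite /min_mult.
case: (boolP (root_is_power h M)) => [/existsP[b /eqP bX]|_].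
  exists (fun=> b) => a; split; first by rewrite prodr_const card_ord bX.
  by rewrite !ord1.
exists (fun a => if a == 0%N :> nat then in_qpoly h 'X else 1) => a.
(* By this formula the shifts of a pass through 0 exactly once, for l = a. *)
have it l : (l <= M)%N -> iter l (@ord_pred _) a = ((a + (M - l)) %% M)%N :> nat.
  elim: l => [|l IHl] lM; first by rewrite subn0 modnDr modn_small.
  have {}IHl := IHl (ltnW lM); rewrite iterS.
  transitivity (((iter l (@ord_pred _) a : nat) + M).-1 %% M)%N; first by [].
  rewrite IHl.
  have aM := ltn_ord a.
  have [E|E] := ltnP (a + (M - l)) M.
    rewrite (modn_small E).
    have -> : ((a + (M - l) + M).-1 = a + (M - l.+1) + M)%N by lia.
    by rewrite modnDr.
  have -> : (a + (M - l) = a - l + M)%N by lia.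
  rewrite modnDr [((a - l) %% M)%N]modn_small; last by lia.
  by congr (_ %% M)%N; lia.
split; last by apply/val_inj; rewrite /= it // subnn addn0 modn_small.
rewrite (bigD1 a) //= it 1?ltnW // subnKC 1?ltnW // modnn eqxx big1 ?mulr1 // => l la.
rewrite it 1?ltnW //; case: eqP => // /eqP.
have aM := ltn_ord a; have lM := ltn_ord l.
have [E|E] := ltnP (a + (M - l)) M; first by rewrite modn_small //; lia.
have -> : (a + (M - l) = a - l + M)%N by lia.
rewrite modnDr modn_small; last by lia.
by move: la; rewrite -val_eqE /=; lia.
Qed.

(** The M-th power of the weighted cyclic shift of [root_coef] is the
    multiplication by X in each summand. *)
Lemma model_root n (A : 'M[F]_n.+1) (phi : 'cV[F]_n.+1 -> qprod f) :
  decomposes A phi -> exists Y : 'M[F]_n.+1, Y ^+ M = A.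
Proof.
move=> Ad; have phiL := decomposes_linear Ad; have [phiB phiD phiA] := Ad.
have cP j := root_coef (gi j).
pose c j := sval (cid (cP j)).
have cE j a : \prod_(l < M) c j (iter l (@ord_pred _) a) = in_qpoly (g j) 'X.
  exact: (svalP (cid (cP j)) a).1.
have cyc j a : iter M (@ord_pred (min_mult (g j))) a = a.
  exact: (svalP (cid (cP j)) a).2.
pose nx (i : I) : I := existT _ (tag i) (ord_pred (tagged i)).
pose T (w : qprod f) : qprod f :=
  [ffun i => c (tag i) (tagged i) * (w (nx i) : {poly %/ f i})].
have TL : qprod_linear T.
  by split=> [w w' w'' E i|k w w'' E i]; rewrite !ffunE E ?mulrDr // scalerAr.
have [Y HY] := mx_of_map phiL phiL phiB TL.
exists Y.
have itY k v j a : phi (Y ^+ k *m v) (existT _ j a) =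
    (\prod_(l < k) c j (iter l (@ord_pred _) a))
      * (phi v (existT _ j (iter k (@ord_pred _) a)) : {poly %/ g j}).
  elim: k v => [|k IHk] v; first by rewrite big_ord0 mul1r mul1mx.
  by rewrite exprSr -mulmxA IHk HY ffunE big_ord_recr /= mulrA.
have H (v : 'cV_n.+1) : Y ^+ M *m v = A *m v.
  apply: (bij_inj phiB); apply/ffunP => -[j a].
  by rewrite itY cE cyc -[A]horner_mx_X phiA.
apply/matrixP => i j; have := congr1 (fun B : 'cV_n.+1 => B i 0) (H (delta_mx j 0)).
by rewrite -!colE !mxE.
Qed.
End Model.
End Roots.

(** * Classes as weighted multiplicity functions *)

(** Both maps list the same values with the same multiplicities, so one list
    is a permutation of the other. *)
Lemma fiber_bij (I J : finType) (T : eqType) (f : I -> T) (g : J -> T) :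
  (forall x, #|[pred i | f i == x]| = #|[pred j | g j == x]|) ->
  exists2 s : J -> I, bijective s & forall j, f (s j) = g j.
Proof.
move=> H.
have cnt (K : finType) (k : K -> T) x : count_mem x (codom k) = #|[pred i | k i == x]|.
  by rewrite count_map -size_filter cardE enumT.
have pr : perm_eq (codom g) (codom_tuple f).
  by apply/allP => x _ /=; rewrite !cnt H.
have cIJ : #|J| = #|I| by rewrite -(size_codom f) -(size_codom g) (perm_size pr).
have [p pE] := tuple_permP pr.
exists (fun j => enum_val (p (cast_ord cIJ (enum_rank j)))) => [|j].
  apply: inj_card_bij; last by rewrite cIJ.
  by move=> j j' /enum_val_inj/perm_inj/cast_ord_inj/enum_rank_inj.
have := congr1 (fun s => nth (g j) s (enum_rank j)) pE.
rewrite nth_codom enum_rankK => ->.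
rewrite -(tnth_nth _ _ (cast_ord cIJ (enum_rank j))) tnth_mktuple.
by rewrite (tnth_nth (g j)) /= nth_codom.
Qed.

Section Classes.
Variable F : finFieldType.
Notation q := #|F|.

Lemma horner_mx_intertwine n (A B P : 'M[F]_n.+1) p :
  P *m B = A *m P -> P *m horner_mx B p = horner_mx A p *m P.
Proof.
move=> PB; elim/poly_ind: p => [|p c IHp]; first by rewrite !rmorph0 mulmx0 mul0mx.
rewrite !rmorphD !rmorphM /= !horner_mx_C !horner_mx_X mulmxDr mulmxDl scalar_mxC.
by congr (_ + _); rewrite mulmxA IHp -!mulmxA PB.
Qed.

Lemma decomposes_transport n (A B P : 'M[F]_n.+1) (I : finType) (f : I -> {poly F})
    (phi : 'cV[F]_n.+1 -> qprod f) :
  P \in unitmx -> P *m B = A *m P -> decomposes A phi ->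
    decomposes B (fun v => phi (P *m v)).
Proof.
move=> Pu PB [phiB phiD phiA]; split.
- apply: bij_comp phiB _; exists (fun v => invmx P *m v) => v; first exact: mulKmx.
  exact: mulKVmx.
- by move=> u v i; rewrite mulmxDr phiD.
by move=> p v i; rewrite mulmxA (horner_mx_intertwine p PB) -mulmxA phiA.
Qed.

Lemma qprod_cast (I : finType) (f : I -> {poly F}) (w : qprod f) i j :
  i = j -> in_qpoly (f j) (val (w i)) = w j.
Proof. by move=> ij; case: j / ij; rewrite in_qpoly_val. Qed.

Lemma decomposes_semisimple n (A : 'M[F]_n.+1) (I : finType) (f : I -> {poly F})
    (phi : 'cV[F]_n.+1 -> qprod f) :
  (forall i, irr_notX (f i)) -> decomposes A phi -> semisimple_mx A.
Proof.
move=> fi [[psi phiK psiK] phiD phiA].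
exists #|I|, (fun k => f (enum_val k)), (fun v => [ffun k => phi v (enum_val k)]);
  split.
- by move=> k; apply/irr_notXP.
- pose back (w : {dffun forall k : 'I_#|I|, {poly %/ f (enum_val k)}}) : qprod f :=
    [ffun i => in_qpoly (f i) (val (w (enum_rank i)))].
  exists (fun w => psi (back w)) => [v|w].
    apply: (canLR phiK); apply/ffunP => i; rewrite !ffunE.
    by apply: qprod_cast; rewrite enum_rankK.
  apply/ffunP => k; rewrite !ffunE psiK ffunE.
  by apply: (@qprod_cast _ (fun k => f (enum_val k))); rewrite enum_valK.
- by move=> u v k; rewrite !ffunE phiD.
by move=> p v k; rewrite !ffunE phiA.
Qed.

Lemma semisimple_decomposes n (A : 'M[F]_n.+1) : semisimple_mx A ->
  exists k (f : 'I_k -> {poly F}) (phi : 'cV[F]_n.+1 -> qprod f),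
    (forall i, irr_notX (f i)) /\ decomposes A phi.
Proof.
case=> k [f [phi [fi phiB phiD phiA]]]; exists k, f, phi; split; last by split.
by move=> i; apply/irr_notXP; apply: fi.
Qed.

(** The kernels of h(A) and h(B) are exchanged by P, so this is [card_ker] for
    both decompositions. *)
Lemma decomposes_fiber n (A B P : 'M[F]_n.+1) (I J : finType) (f : I -> {poly F})
    (g : J -> {poly F}) (phi : 'cV[F]_n.+1 -> qprod f)
    (chi : 'cV[F]_n.+1 -> qprod g) h :
  (forall i, irr_notX (f i)) -> (forall j, irr_notX (g j)) ->
  decomposes A phi -> decomposes B chi ->
  P \in unitmx -> P *m B = A *m P ->
  irr_notX h -> #|[pred i | f i == h]| = #|[pred j | g j == h]|.
Proof.
move=> fi gi Ad Bd Pu PB hi.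
have := card_ker gi hi Bd; have := card_ker fi hi (decomposes_transport Pu PB Ad).
move=> -> /(expnI (finNzRing_gt1 F))/eqP.
by rewrite eqn_pmul2l ?(deg_gt0 hi) // => /eqP.
Qed.

Section Count.
Variables (M N n : nat).
Hypotheses (Mp : prime M) (nN : (n.+2 <= N)%N).
Local Notation S := {f : {poly_N F} | irr_notX (f : {poly F})}.
Local Notation mults := {ffun S -> 'I_n.+2}.
Local Notation vp x := (\val (\val x) : {poly F}).

(** A function mu prescribes mu x blocks for each irreducible polynomial x; a
    block of x is made of [min_mult] copies of F[X]/(x).  Values of mu never
    exceed the dimension, which keeps the functions in a finite type. *)
Definition blocks (mu : mults) := {x : S & 'I_(mu x)}.
Definition block_poly mu (j : blocks mu) : {poly F} := vp (tag j).
Definition summands (mu : mults) := {j : blocks mu & 'I_(min_mult M (block_poly j))}.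
Definition summand_poly mu (i : summands mu) : {poly F} := block_poly (tag i).

Lemma block_irr mu (j : blocks mu) : irr_notX (block_poly j).
Proof. exact: (valP (tag j)). Qed.

Lemma summand_irr mu (i : summands mu) : irr_notX (summand_poly i).
Proof. exact: block_irr. Qed.

Lemma sum_summands mu (G : {poly F} -> nat) :
  (\sum_(i : summands mu) G (summand_poly i)
   = \sum_(x : S) mu x * (min_mult M (vp x) * G (vp x)))%N.
Proof.
rewrite -(@sig_big_dep _ _ _ (blocks mu) (fun j => 'I_(min_mult M (block_poly j))) predT
  (fun _ => predT) (fun j _ => G (block_poly j))) /=.
rewrite -(@sig_big_dep _ _ _ S (fun x => 'I_(mu x)) predT (fun _ => predT)
  (fun x _ => \sum_(a < min_mult M (vp x)) G (vp x)))%N /=.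
by apply: eq_bigr => x _; rewrite !sum_nat_const !card_ord.
Qed.

Lemma card_summands mu h : #|[pred i : summands mu | summand_poly i == h]| =
  (\sum_(x : S) mu x * (min_mult M (vp x) * (vp x == h)))%N.
Proof.
rewrite -(sum_summands mu (fun g => nat_of_bool (g == h))) -sum1_card big_mkcond /=.
by apply: eq_bigr => i _; rewrite inE; case: eqP.
Qed.

Lemma card_summands_val mu (x : S) :
  #|[pred i : summands mu | summand_poly i == vp x]| = (mu x * min_mult M (vp x))%N.
Proof.
rewrite card_summands (bigD1 x) //= eqxx muln1 big1 ?addn0 // => y yx.
by rewrite !val_eqE (negPf yx) !muln0.
Qed.

Lemma wdeg_min_mult (h : {poly F}) : wdeg M h = (min_mult M h * deg h)%N.
Proof. by rewrite /wdeg /min_mult; case: root_is_power; rewrite ?mul1n. Qed.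

Definition weight (mu : mults) := (\sum_(x : S) mu x * wdeg M (vp x))%N.

Lemma weightE mu : (\sum_(i : summands mu) (size (summand_poly i)).-1 = weight mu)%N.
Proof.
rewrite (sum_summands mu (fun g => (size g).-1)).
by apply: eq_bigr => x _; rewrite wdeg_min_mult.
Qed.

Local Notation GL := {'GL_n.+1[F]}.

Lemma exists_model mu : weight mu = n.+1 ->
  exists (a x : GL) phi,
    decomposes (GLval a) (f := @summand_poly mu) phi /\ (x ^+ M)%g = a.
Proof.
move=> wmu; have := weightE mu; rewrite wmu.
move=> /(exists_decomposes (@summand_irr mu))[A [phi Ad]].
have Au := decomposes_unit (@summand_irr mu) Ad.
have [X XM] := model_root Mp (@block_irr mu) Ad.
have Xu : X \in unitmx.
  by rewrite -[_ \in _]/(X \is a GRing.unit) -(unitrX_pos X (prime_gt0 Mp)) XM.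
exists (FinRing.unit _ (Au : A \is a GRing.unit)),
  (FinRing.unit _ (Xu : X \is a GRing.unit)), phi.
by split=> //; apply/val_inj; rewrite FinRing.val_unitX.
Qed.

Lemma GL_conj (a b : GL) (P : 'M[F]_n.+1) : P \in unitmx ->
  P *m GLval a = GLval b *m P -> a \in (b ^: [set: GL])%g.
Proof.
move=> Pu PE; pose p : GL := FinRing.unit _ (Pu : P \is a GRing.unit).
apply/imsetP; exists p; first by rewrite inE.
rewrite conjgE; apply: (mulgI p); rewrite mulgA mulgV mul1g.
exact/val_inj.
Qed.

Lemma GL_conjP (a b : GL) : a \in (b ^: [set: GL])%g ->
  exists2 P : 'M[F]_n.+1, P \in unitmx & P *m GLval a = GLval b *m P.
Proof.
case/imsetP => p _ ab; exists (GLval p); first exact: (valP p).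
have : (p * a = b * p)%g by rewrite ab conjgE mulgA mulgV mul1g.
by move/(congr1 val).
Qed.

(** All the multiplicities of an M-th power are multiples of [min_mult], by
    [nonpower_multiplicity]; mu is given by the quotients. *)
Lemma ss_class_model (a : GL) : semisimple_mx (GLval a) ->
  (exists x : GL, a = (x ^+ M)%g) ->
  exists mu (I : finType) (f : I -> {poly F}) (phi : 'cV[F]_n.+1 -> qprod f)
    (s : I -> summands mu),
    [/\ weight mu = n.+1, decomposes (GLval a) phi, bijective s
      & forall i, summand_poly (s i) = f i].
Proof.
move=> /semisimple_decomposes[k [f [phi [fi Ad]]]] [x ax].
have dimA := decomposes_dim fi Ad.
have fib_le h : (#|[pred i | f i == h]| <= n.+1)%N.
  rewrite -dimA -sum1_card big_mkcond; apply: leq_sum => i _ /=.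
  by case: ifP => // _; apply: deg_gt0 (fi i).
have fN i : (size (f i) <= N)%N.
  apply: leq_trans nN; have : ((size (f i)).-1 <= n.+1)%N.
    by rewrite -dimA (bigD1 i) //= leq_addr.
  by case: (size (f i)).
have fib_dvd (h : {poly F}) : irr_notX h -> (min_mult M h %| #|[pred i | f i == h]|)%N.
  move=> hi; rewrite /min_mult; case: ifP => [_|/negbT np]; first exact: dvd1n.
  apply: (nonpower_multiplicity Mp fi hi Ad (Y := GLval x)) => //.
  by rewrite ax; symmetry; apply: FinRing.val_unitX.
pose mu : mults :=
  [ffun y : S => inord (#|[pred i | f i == vp y]| %/ min_mult M (vp y))].
have muE y : (mu y * min_mult M (vp y) = #|[pred i | f i == vp y]|)%N.
  rewrite ffunE inordK ?divnK ?fib_dvd ?(valP y) //.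
  by rewrite ltnS (leq_trans (leq_div _ _)).
have [s sB sE] : exists2 s : 'I_k -> summands mu, bijective s &
    forall i, summand_poly (s i) = f i.
  apply: fiber_bij => h.
  have [/andP[hi hN]|nh] := boolP (irr_notX h && (size h <= N)%N).
    have hi' : irr_notX (npolyp N h : {poly F}) by rewrite npolypK.
    have hE : vp (exist _ (npolyp N h) hi' : S) = h by rewrite /= npolypK.
    by rewrite -{1}hE card_summands_val muE hE.
  rewrite card_summands big1 ?[RHS]eq_card0 // => [i|y _].
    by rewrite inE; apply: contraNF nh => /eqP <-; rewrite fi fN.
  have [E|_] := eqVneq; last by rewrite !muln0.
  by move: nh; rewrite -E (valP y) size_npoly.
exists mu, 'I_k, f, phi, s; split=> //.
rewrite -weightE; transitivity (\sum_i (size (f i)).-1)%N; last exact: dimA.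
rewrite (reindex s); first by apply: eq_bigr => i _; rewrite sE.
exact: onW_bij.
Qed.

(** Sending mu to the class of a matrix with the prescribed summands is a
    bijection onto the classes to be counted: it is injective because the
    multiplicities are conjugacy invariants, its values are classes of M-th
    powers by [model_root], and all such classes arise by [ss_class_model]. *)
Lemma c_ssE : c_ss F n.+1 M = #|[set mu : mults | weight mu == n.+1]|.
Proof.
have /choice[A HA] : forall mu, exists a : GL, weight mu = n.+1 ->
    exists (x : GL) phi,
      decomposes (GLval a) (f := @summand_poly mu) phi /\ (x ^+ M)%g = a.
  move=> mu; have [/exists_model[a H]|nw] := eqVneq (weight mu) n.+1; first by exists a.
  by exists 1%g => w; rewrite w eqxx in nw.
rewrite -(@card_in_imset _ _ (fun mu => (A mu ^: [set: GL])%g)).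
  rewrite /c_ss; apply: eq_card => C; rewrite inE; apply/and3P/imsetP.
    case=> /imsetP[a _ CE] /asboolP Css Cim.
    have aC : a \in C by rewrite CE class_refl.
    have [||mu [I [f [phi [s [wmu Ad sB sE]]]]]] := @ss_class_model a.
    - exact: Css.
    - by have /imsetP[x _ ->] := subsetP Cim a aC; exists x.
    exists mu; first by rewrite inE wmu.
    have [x [chi [Bd _]]] := HA mu wmu.
    have [P Pu PE] := decomposes_conj Bd Ad sB sE.
    by rewrite CE; apply/esym/class_eqP; apply: GL_conj Pu PE.
  case=> mu; rewrite inE => /eqP wmu CE; have [x [chi [Bd xM]]] := HA mu wmu.
  split; first by rewrite CE mem_classes ?inE.
    apply/asboolP => a; rewrite CE => /GL_conjP[P Pu PE].
    exact: decomposes_semisimple (@summand_irr mu) (decomposes_transport Pu PE Bd).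
  apply/subsetP => a; rewrite CE => /imsetP[p _ ->].
  by apply/imsetP; exists (x ^ p)%g; rewrite ?inE // -conjXg xM.
move=> mu nu; rewrite !inE => /eqP wmu /eqP wnu /class_eqP/GL_conjP[P Pu PE].
have [x [phi [Ad _]]] := HA mu wmu; have [y [chi [Bd _]]] := HA nu wnu.
apply/ffunP => z; apply/val_inj/eqP; rewrite -(eqn_pmul2r (min_mult_gt0 Mp (vp z))).
rewrite -!card_summands_val.
by rewrite (decomposes_fiber (@summand_irr nu) (@summand_irr mu) Bd Ad Pu PE (valP z)).
Qed.
End Count.
End Classes.

(** * The generating series *)

Definition fps_Xn (j : nat) : fps := fun i => (i == j)%:R.

Lemma fps_XnD a b : fps_Xn (a + b) = fps_Xn a * fps_Xn b.
Proof.
apply/funext => n; rewrite fpsM /fps_Xn.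
have [E|nE] := eqVneq n (a + b)%N.
  have an : (a < n.+1)%N by rewrite E ltnS leq_addr.
  have nab : (n - a = b)%N by rewrite E addKn.
  rewrite (bigD1 (Ordinal an)) //= eqxx mul1r nab eqxx big1 ?addr0 // => i ia.
  by rewrite -val_eqE /= in ia; rewrite (negPf ia) mul0r.
rewrite big1 // => i _; case: eqP => [ia|_]; last by rewrite mul0r.
rewrite mul1r; case: eqP => // nb; move: nE; rewrite -ia -nb subnKC ?eqxx //.
exact: leq_ord.
Qed.

Lemma fps_Xn_prod (I : finType) (e : I -> nat) :
  \prod_i fps_Xn (e i) = fps_Xn (\sum_i e i).
Proof.
rewrite (big_morph fps_Xn fps_XnD (_ : _ = 1)) //.
Qed.

Lemma fps_prod_eq (I : Type) (r : seq I) (G G' : I -> fps) m :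
  (forall x i, (i <= m)%N -> G x i = G' x i) ->
  forall i, (i <= m)%N -> (\prod_(x <- r) G x) i = (\prod_(x <- r) G' x) i.
Proof.
move=> GG'; elim: r => [|x r IHr] i im; first by rewrite !big_nil.
by rewrite !big_cons; apply: fps_mul_eq im => j jm; [apply: GG'|apply: IHr].
Qed.

(** The series 1 / (1 - u^D). *)
Definition geomD D : fps := fps_comp_Xn D (fps_geom 1).

Lemma geomDE D n : geomD D n = (D %| n)%:R.
Proof. by rewrite /geomD comp_XnE /fps_geom expr1n; case: ifP. Qed.

Lemma geomD_trunc D K n : (0 < D)%N -> (n < K)%N ->
  geomD D n = (\sum_(k < K) fps_Xn (k * D)) n.
Proof.
move=> D0 nK; rewrite geomDE fps_sumE /fps_Xn.
have [Dn|nDn] := boolP (D %| n)%N; last first.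
  rewrite big1 // => k _; case: eqP => // E; move: nDn; rewrite E dvdn_mull //.
have nD : (n %/ D < K)%N by rewrite (leq_ltn_trans (leq_div _ _)).
rewrite (bigD1 (Ordinal nD)) //= divnK // eqxx big1 ?addr0 // => k kn.
case: eqP => // E; move: kn; rewrite -val_eqE /= E mulnK // eqxx //.
Qed.

(** Expanding a product of geometric series; below degree K the series may be
    cut after K terms. *)
Lemma geomD_prod (I : finType) (D : I -> nat) n K :
  (forall x, 0 < D x)%N -> (n < K)%N ->
  (\prod_x geomD (D x)) n
  = #|[set mu : {ffun I -> 'I_K} | (\sum_x mu x * D x == n)%N]|%:R.
Proof.
move=> D0 nK.
rewrite (@fps_prod_eq _ _ _ (fun x => \sum_(k < K) fps_Xn (k * D x)) n) //; last first.
  by move=> x i im; apply: geomD_trunc; rewrite ?D0 // (leq_ltn_trans im).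
rewrite bigA_distr_bigA fps_sumE.
under eq_bigr => mu _ do rewrite fps_Xn_prod /fps_Xn.
rewrite -natr_sum -sum1_card; congr (_%:R).
rewrite [RHS]big_mkcond /=; apply: eq_bigr => mu _.
by rewrite inE eq_sym; case: eqP.
Qed.

Lemma logder_geomD D : (0 < D)%N ->
  logder (geomD D) (fpsC D%:R * fps_comp_Xn D (fps_powers 1)).
Proof. by move=> D0; apply: logder_comp_Xn => //; apply: logder_geom. Qed.

(** The factors of the infinite product are 1 up to high order. *)
Lemma pow_low f L a K : f 0%N = 1 -> logder f L -> (forall i, (i <= K)%N -> L i = 0) ->
  forall i, (i <= K)%N -> fps_pow f a i = (i == 0%N)%:R.
Proof.
move=> f0 fL L0.
apply: (@logder_uniq K _ (1 : fps) (fpsC a * L) 0) => //.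
- exact: fps_pow0.
- by move=> i iK; rewrite fpsC_mul L0 // mulr0.
- exact: logder_pow.
exact: logder1.
Qed.

Lemma prod_stable (G : nat -> fps) n :
  (forall k i, (n < k)%N -> (i <= n)%N -> G k i = (i == 0%N)%:R) ->
  forall K, (n <= K)%N -> forall i, (i <= n)%N ->
  (\prod_(1 <= k < K.+1) G k) i = (\prod_(1 <= k < n.+1) G k) i.
Proof.
move=> G1; elim=> [|K IHK] nK i im; first by move: nK; rewrite leqn0 => /eqP ->.
move: nK; rewrite leq_eqVlt => /orP[/eqP -> //|nK].
rewrite big_nat_recr //= (@fps_mul_eq n _ (\prod_(1 <= k < n.+1) G k) _ 1) ?mulr1 //.
  by move=> j jn; apply: IHK.
by move=> j jn; rewrite G1.
Qed.

(** * Comparison of the two logarithmic derivatives *)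

Lemma order_dvd (M q : nat) (z : {unit 'Z_M}) m : prime M -> (0 < q)%N ->
  FinRing.uval z = q%:R -> (#[z]%g %| m)%N = (M %| (q ^ m).-1)%N.
Proof.
move=> Mp q0 zq; rewrite order_dvdn.
have -> : (z ^+ m == 1)%g = ((q ^ m)%:R == 1%:R :> 'Z_M).
  by rewrite -val_eqE [val (z ^+ m)%g]FinRing.val_unitX [val z]zq natrX.
have M1 := prime_gt1 Mp.
rewrite -subn1 -(@eqn_mod_dvd M (q ^ m) 1) ?expn_gt0 ?q0 // -val_eqE.
by rewrite -(val_Zp_nat M1 (q ^ m)) -(val_Zp_nat M1 1).
Qed.

Section Count.
Variables (F : finFieldType) (M N : nat).
Hypothesis Mp : prime M.
Notation q := #|F|.

(** The recursion of [nonpower_degs_rec], unfolded until m is exhausted. *)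
Lemma nonpower_degs_sum K m : (0 < m)%N -> (m < M ^ K)%N -> (q ^ m <= N)%N ->
  nonpower_degs F M N m =
    (\sum_(k < K) if M ^ k %| m then new_nonpowers F M (m %/ M ^ k) else 0)%N.
Proof.
elim: K m => [|K IHK] m m0 mK mN; first by move: mK; rewrite expn0 ltnS leqn0 gtn_eqF.
rewrite nonpower_degs_rec // big_ord_recl expn0 dvd1n divn1; congr (_ + _)%N.
case: ifP => [Mm|Mm]; last first.
  rewrite big1 // => k _; case: ifP => // /(dvdn_trans _) H.
  by rewrite H // /bump /= expnS dvdn_mulr in Mm.
have mM0 : (0 < m %/ M)%N by rewrite divn_gt0 ?prime_gt0 // dvdn_leq.
rewrite IHK //.
- apply: eq_bigr => k _; rewrite /bump /= expnS divnMA.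
  by rewrite -[X in (M * _ %| X)%N](divnK Mm) mulnC dvdn_pmul2r ?prime_gt0.
- by rewrite ltn_divLR ?prime_gt0 // -expnSr.
apply: leq_trans mN; rewrite leq_exp2l ?finNzRing_gt1 //; exact: leq_div.
Qed.

Lemma new_nonpowers_rat m : (0 < m)%N -> (new_nonpowers F M m)%:R =
  (if (M %| (q ^ m).-1)%N then (M%:R - 1) / M%:R * (q%:R ^+ m - 1) else 0) :> rat.
Proof.
move=> m0; rewrite /new_nonpowers; case: ifP => // Md.
have M0 : M%:R != 0 :> rat by rewrite pnatr_eq0 -lt0n prime_gt0.
have -> : q%:R ^+ m - 1 = (q ^ m).-1%:R :> rat.
  by rewrite -natrX -subn1 natrB // expn_gt0 ltnW // finNzRing_gt1.
by rewrite natrB ?leq_div // -{1 3}(divnK Md) natrM; field.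
Qed.

Lemma wdeg_sum_rat K m : (0 < m)%N -> (m < M ^ K.+1)%N -> (q ^ m <= N)%N ->
  (\sum_(f : {poly_N F} | irr_notX (f : {poly F}) && (wdeg M f %| m)) wdeg M f)%N%:R
  = (q%:R ^+ m - 1) - (new_nonpowers F M m)%:R + (M%:R - 1) *
    (\sum_(k < K) if M ^ k.+1 %| m then new_nonpowers F M (m %/ M ^ k.+1) else 0)%N%:R
  :> rat.
Proof.
move=> m0 mK mN.
pose X := (if M %| m then nonpower_degs F M N (m %/ M) else 0)%N.
have E1 : nonpower_degs F M N m = (new_nonpowers F M m + X)%N.
  exact: nonpower_degs_rec.
have <- : X = (\sum_(k < K)
    if M ^ k.+1 %| m then new_nonpowers F M (m %/ M ^ k.+1) else 0)%N.
  have := @nonpower_degs_sum K.+1 m m0 mK mN.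
  by rewrite E1 big_ord_recl expn0 dvd1n divn1 => /addnI.
have := @wdeg_sum F M N Mp m m0 mN; set W := (\sum_(f | _) _)%N.
have -> : (if M %| m then M * nonpower_degs F M N (m %/ M) else 0)%N = (M * X)%N.
  by rewrite /X; case: ifP; rewrite ?muln0.
rewrite E1 => /(congr1 (fun n => n%:R : rat)); rewrite !natrD natrM.
have -> : (q ^ m).-1%:R = q%:R ^+ m - 1 :> rat.
  by rewrite -natrX -subn1 natrB // expn_gt0 ltnW // finNzRing_gt1.
by move=> EW; apply: (addIr ((new_nonpowers F M m)%:R + X%:R)); rewrite EW; ring.
Qed.
End Count.

Section Main.
Variables (M : nat) (F : finFieldType) (z : {unit 'Z_M}).
Hypotheses (Mp : prime M) (zq : FinRing.uval z = #|F|%:R).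
Notation q := #|F|.
Let t := #[z]%g.

Lemma t_dvd m : (t %| m)%N = (M %| (q ^ m).-1)%N.
Proof. by apply: order_dvd => //; rewrite ltnW // finNzRing_gt1. Qed.

Definition factor (k : nat) : fps :=
  fps_pow (fps_comp_Xn (M ^ k * t) (cser (q%:R ^+ t)))
    ((1 - M%:R) ^+ 2 / (M ^ k.+1 * t)%:R).
(** The factor outside the infinite product, other than c(q, u). *)
Definition factor0 : fps :=
  fps_pow (fps_comp_Xn t (cser (q%:R ^+ t))) ((1 - M%:R) / (M * t)%:R).

Lemma t_gt0 : (0 < t)%N. Proof. exact: order_gt0. Qed.
Lemma Mkt_gt0 k : (0 < M ^ k * t)%N.
Proof. by rewrite muln_gt0 expn_gt0 prime_gt0 ?t_gt0. Qed.

Lemma factor_const k : factor k 0%N = 1.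
Proof. by rewrite /factor fps_pow0 // comp_Xn0 ?Mkt_gt0 // cser0. Qed.

Lemma factor_logder k : logder (factor k)
  (fpsC ((1 - M%:R) ^+ 2 / (M ^ k.+1 * t)%:R) *
   (fpsC (M ^ k * t)%:R * fps_comp_Xn (M ^ k * t) (cser_log (q%:R ^+ t)))).
Proof.
apply: logder_pow; first by rewrite comp_Xn0 ?Mkt_gt0 // cser0.
by apply: logder_comp_Xn; [exact: Mkt_gt0|exact: logder_cser].
Qed.

Lemma factor0_const : factor0 0%N = 1.
Proof. by rewrite /factor0 fps_pow0 // comp_Xn0 ?t_gt0 // cser0. Qed.

Lemma factor0_logder : logder factor0 (fpsC ((1 - M%:R) / (M * t)%:R) *
   (fpsC t%:R * fps_comp_Xn t (cser_log (q%:R ^+ t)))).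
Proof.
apply: logder_pow; first by rewrite comp_Xn0 ?t_gt0 // cser0.
by apply: logder_comp_Xn; [exact: t_gt0|exact: logder_cser].
Qed.

(** This power of c(q^t, u^(M^k t)) is 1 up to degree M^k t - 1 >= k. *)
Lemma factor_low k i n : (n < k)%N -> (i <= n)%N -> factor k i = (i == 0%N)%:R.
Proof.
move=> nk; apply: (@pow_low _
  (fpsC (M ^ k * t)%:R * fps_comp_Xn (M ^ k * t) (cser_log (q%:R ^+ t)))).
- by rewrite comp_Xn0 ?Mkt_gt0 // cser0.
- by apply: logder_comp_Xn; [exact: Mkt_gt0|exact: logder_cser].
move=> j jn; rewrite fpsC_mul comp_XnE; case: ifP => [/dvdnP[[|l] E]|_];
  rewrite ?mulr0 //.
  by rewrite E div0n cser_logE mulr0.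
have : (k < M ^ k * t)%N.
  rewrite (leq_trans (ltn_expl k (prime_gt1 Mp))) // leq_pmulr // t_gt0 //.
have : (M ^ k * t <= j)%N by rewrite E mulSn leq_addr.
lia.
Qed.

(** The diagonal of the partial products: by [factor_low] the coefficient of
    u^n no longer changes after the n-th factor. *)
Definition factor_prod : fps := fun n => (\prod_(1 <= k < n.+1) factor k) n.

Lemma factor_prodE n K i : (i <= n)%N -> (n <= K)%N ->
  factor_prod i = (\prod_(1 <= k < K.+1) factor k) i.
Proof.
move=> iN nK; rewrite /factor_prod -(@prod_stable factor i _ K) //;
  last exact: leq_trans nK.
by move=> k j ik ji; apply: factor_low ik ji.
Qed.

(** Divisibility by t is translated into the condition of [new_nonpowers]. *)
Lemma comp_cser_logE m k : (0 < m)%N ->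
  fps_comp_Xn (M ^ k * t) (cser_log (q%:R ^+ t)) m =
  if (M ^ k %| m)%N && (M %| (q ^ (m %/ M ^ k)).-1)%N
  then q%:R ^+ (m %/ M ^ k) - 1 else 0.
Proof.
move=> m0; rewrite comp_XnE cser_logE -t_dvd.
have Mk0 : (0 < M ^ k)%N by rewrite expn_gt0 prime_gt0.
have -> : (M ^ k %| m)%N && (t %| m %/ M ^ k)%N = (M ^ k * t %| m)%N.
  apply/andP/idP => [[Mm]|H]; first by rewrite dvdn_divRL // mulnC.
  have Mm : (M ^ k %| m)%N by apply: dvdn_trans H; apply: dvdn_mulr.
  by rewrite Mm dvdn_divRL // mulnC.
case: ifP => // d; rewrite gtn_eqF; last first.
  by rewrite divn_gt0 ?Mkt_gt0 // dvdn_leq.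
rewrite -exprM; congr (_ ^+ _ - _).
rewrite divnMA mulnC divnK // dvdn_divRL; first by rewrite mulnC.
by apply: dvdn_trans d; apply: dvdn_mulr.
Qed.

(** Both series have constant term 1, so by [logder_uniq] it suffices to compare
    their logarithmic derivatives up to degree n.  With T(m) standing for
    [new_nonpowers], that of the left-hand side is (q^m - 1) - T(m) plus
    (M - 1) times the sum of the T(m / M^k) for k >= 1 [wdeg_sum_rat]; these
    three parts come from c(q, u), from [factor0] and from the product. *)
Lemma ss_coef n K : (n <= K)%N ->
  ss_series F M n = (cser q%:R * factor0 * \prod_(1 <= k < K.+1) factor k) n.
Proof.
move=> nK.
have [->|] := posnP n.
  by rewrite !fpsM0 cser0 factor0_const fps_prod0 ?mulr1 // => i _; apply: factor_const.
case: n nK => // n nK _.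
(* Polynomials of size at most N include X^(q^m - 1) - 1 for m <= n + 1, and
   all irreducible polynomials of degree at most n + 1. *)
pose N := (q ^ n.+1)%N.
have nN : (n.+2 <= N)%N by apply: ltn_expl; apply: finNzRing_gt1.
pose S := {f : {poly_N F} | irr_notX (f : {poly F})}.
pose D (x : S) := wdeg M (val (val x)).
have D0 x : (0 < D x)%N.
  by rewrite /D wdeg_min_mult muln_gt0 min_mult_gt0 // deg_gt0 // (valP x).
transitivity ((\prod_x geomD (D x)) n.+1).
  by rewrite (@geomD_prod _ _ _ n.+2) // /ss_series /= (@c_ssE _ M N).
have LM : logder (cser q%:R) (cser_log q%:R) by apply: logder_cser.
have LG := @logder_prod S (index_enum _) predT _ _ (fun x _ => logder_geomD (D0 x)).
have LR := logderM (logderM LM factor0_logder)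
  (@logder_prod _ (index_iota 1 K.+1) predT _ _ (fun k _ => factor_logder k)).
apply: (logder_uniq _ _ _ LG LR (leqnn n.+1)).
- by apply: fps_prod0 => x _; rewrite /geomD comp_Xn0.
- by rewrite !fpsM0 cser0 factor0_const fps_prod0 ?mulr1 // => i _; apply: factor_const.
move=> m mn; have [->|m0] := posnP m.
  rewrite !fpsD fps_sumE big1 => [|x _]; last first.
    by rewrite fpsC_mul comp_Xn0 // /fps_powers mulr0.
  rewrite fps_sumE big1 => [|k _]; last first.
    by rewrite !fpsC_mul comp_Xn0 ?Mkt_gt0 // cser_logE !mulr0.
  by rewrite !fpsC_mul comp_Xn0 ?t_gt0 // !cser_logE !mulr0 !addr0.
have mN : (q ^ m <= N)%N by rewrite leq_exp2l // finNzRing_gt1.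
have -> : (\sum_x fpsC (D x)%:R * fps_comp_Xn (D x) (fps_powers 1)) m
  = (\sum_(f : {poly_N F} | irr_notX (f : {poly F}) && (wdeg M f %| m)) wdeg M f)%N%:R.
  rewrite fps_sumE [RHS]natr_sum big_mkcondr /=.
  rewrite (@big_sub _ _ _ _ (fun f : {poly_N F} => irr_notX (f : {poly F}))).
  apply: eq_bigr => x _; rewrite fpsC_mul comp_XnE.
  case: ifP => // Dm; rewrite ?mulr0 // /fps_powers expr1n gtn_eqF ?mulr1 //.
  by rewrite divn_gt0 // dvdn_leq.
rewrite (@wdeg_sum_rat F M N Mp K) //; last first.
  rewrite (leq_ltn_trans mn) // (leq_ltn_trans nK) // ltnW // ltn_expl //.
  exact: prime_gt1.
have M0 : M%:R != 0 :> rat by rewrite pnatr_eq0 -lt0n prime_gt0.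
have t0 : t%:R != 0 :> rat by rewrite pnatr_eq0 -lt0n t_gt0.
rewrite !fpsD cser_logE gtn_eqF //; congr (_ + _ + _).
  rewrite !fpsC_mul -[t in fps_comp_Xn t]mul1n -(expn0 M) comp_cser_logE // expn0 dvd1n
    divn1 new_nonpowers_rat //.
  case: ifP => _; last by rewrite !mulr0 oppr0.
  by rewrite natrM /=; set y := (_ ^+ m - 1 : rat); field; rewrite M0 t0.
rewrite natr_sum fps_sumE big_add1 big_mkord mulr_sumr; apply: eq_bigr => k _.
rewrite !fpsC_mul comp_cser_logE //; case: (boolP (M ^ k.+1 %| m)%N) => [Mm|_] /=;
  last by rewrite !mulr0.
rewrite new_nonpowers_rat //; last first.
  by rewrite divn_gt0 ?expn_gt0 ?prime_gt0 // dvdn_leq.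
case: ifP => _; last by rewrite !mulr0.
have Mk : M%:R ^+ k != 0 :> rat by rewrite expf_neq0.
rewrite !natrM !natrX !exprS; field; by rewrite M0 t0 Mk.
Qed.

End Main.

Theorem theorem8p5 (M : nat) (F : finFieldType) (q : nat) (z : {unit 'Z_M})
    (t : nat) :
  prime M ->
  #|F| = q ->
  coprime M q ->
  FinRing.uval z = q%:R ->
  t = #[z]%g ->
  exists P : fps,
    fps_infprod
      (fun k => fps_pow (fps_comp_Xn (M ^ k * t) (cser (q%:R ^+ t)))
                  ((1 - M%:R) ^+ 2 / (M ^ k.+1 * t)%:R)) P
    /\ ss_series F M =1
       fps_mul
         (fps_mul (cser q%:R)
            (fps_pow (fps_comp_Xn t (cser (q%:R ^+ t)))
               ((1 - M%:R) / (M * t)%:R)))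
         P.
Proof.
move=> Mp <- _ zq ->; exists (factor_prod F z); split=> [n|n].
  by exists n => K nK; rewrite (factor_prodE F z Mp (leqnn n) nK).
rewrite (ss_coef Mp zq (leqnn n)); apply: (@fps_mul_eq n) => // i iN.
by rewrite (factor_prodE F z Mp iN (leqnn n)).
Qed.
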